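(* Let $\mathcal{G}$ be a proper minor-closed family of graphs. There exist a constant $c_{\mathcal{G}}>0$, depending only on $\mathcal{G}$, and a polynomial-time algorithm with the following guarantee. Given a connected graph $G=(V,E)$ in $\mathcal{G}$ together with node capacities $\mathrm{cap}:V\to\mathbb{R}_{\ge 0}$, where $k$ denotes the minimum capacity of a node separator of $G$, the algorithm outputs a fractional connected domatic packing of $G$ (respecting $\mathrm{cap}$) of size at least $c_{\mathcal{G}}\cdot k$, i.e.\ of size $\Omega(k)$.
   Context: All graphs are finite, simple, undirected. A set $D\subseteq V$ is a dominating set if every vertex outside $D$ has a neighbor in $D$; it is a connected dominating set if moreover the induced subgraph $G[D]$ is connected. A set $S\subseteq V$ is a node separator if $G-S$ (the graph obtained by deleting the vertices of $S$) has at least two connected components. The capacity of a set $S$ is $\sum_{v\in S}\mathrm{cap}(v)$. A fractional connected domatic packing respecting $\mathrm{cap}$ is a finite collection of connected dominating sets $D_1,\dots,D_\ell$ with weights $\alpha_1,\dots,\alpha_\ell\ge 0$ such that for every vertex $v$, $\sum_{i:v\in D_i}\alpha_i\le \mathrm{cap}(v)$; its size is $\sum_i\alpha_i$. A family of graphs is minor-closed if it is closed under taking minors; it is proper if it does not contain all graphs (equivalently, it excludes some fixed graph $H$ as a minor). *)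

(* Defs.v *)
(* MathComp, with an abstract [R : realType] for the real numbers. *)
From mathcomp Require Import all_boot all_order all_algebra.
From mathcomp Require Import reals.

Set Implicit Arguments.
Unset Strict Implicit.
Unset Printing Implicit Defensive.

Import Order.TTheory GRing.Theory Num.Theory.
Local Open Scope ring_scope.

(* The vertex set is {0, ..., gorder - 1}, so that a graph is directly an input
   for a machine.  A minor-closed family is closed under isomorphism (see
   [minor] below), hence loses nothing by this choice. *)
Record sgraph := SGraph {
  gorder : nat;
  adj : rel 'I_gorder;
  adj_sym : symmetric adj;
  adj_irrefl : irreflexive adj
}.

Definition vertex (G : sgraph) : finType := 'I_(gorder G).

Definition induced_adj (G : sgraph) (A : {set vertex G}) : rel (vertex G) :=
  [rel x y | [&& x \in A, y \in A & adj x y]].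

Definition num_components (G : sgraph) (A : {set vertex G}) : nat :=
  n_comp (induced_adj A) A.

(* In particular the empty set is not connected. *)
Definition connected_set (G : sgraph) (A : {set vertex G}) : bool :=
  num_components A == 1%N.

Definition connected_graph (G : sgraph) : bool := connected_set [set: vertex G].

Definition dominating (G : sgraph) (D : {set vertex G}) : bool :=
  [forall v, (v \notin D) ==> [exists u in D, adj v u]].

Definition connected_dominating (G : sgraph) (D : {set vertex G}) : bool :=
  dominating D && connected_set D.

Definition node_separator (G : sgraph) (S : {set vertex G}) : bool :=
  (1 < num_components (~: S))%N.

(* H is a minor of G: [B x] is the branch set contracted to the vertex x. *)
Definition minor (H G : sgraph) : Prop :=
  exists B : vertex H -> {set vertex G},
    [/\ forall x, connected_set (B x),
        forall x y, x != y -> [disjoint B x & B y]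
      & forall x y : vertex H, adj x y ->
          exists u v : vertex G, [/\ u \in B x, v \in B y & adj u v]].

Definition minor_closed (F : sgraph -> Prop) : Prop :=
  forall G H : sgraph, F G -> minor H G -> F H.

Definition proper_family (F : sgraph -> Prop) : Prop :=
  exists G : sgraph, ~ F G.

Definition capacity (R : realType) (G : sgraph) (cap : vertex G -> R)
    (S : {set vertex G}) : R :=
  \sum_(v in S) cap v.

(* There is no such k exactly when G has no node separator (G complete). *)
Definition min_separator_capacity (R : realType) (G : sgraph)
    (cap : vertex G -> R) (k : R) : Prop :=
  (exists S, node_separator S /\ capacity cap S = k) /\
  (forall S, node_separator S -> k <= capacity cap S).

Definition fractional_cd_packing (R : realType) (G : sgraph)
    (cap : vertex G -> R) (L : seq ({set vertex G} * R)) : Prop :=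
  [/\ {in L, forall Da, connected_dominating Da.1},
      {in L, forall Da, 0 <= Da.2}
    & forall v, \sum_(Da <- L | v \in Da.1) Da.2 <= cap v].

Definition packing_size (R : realType) (G : sgraph)
    (L : seq ({set vertex G} * R)) : R :=
  \sum_(Da <- L) Da.2.

(** * Model of computation

  A real RAM, presented as a while language.  Memory consists of integer arrays
  and real arrays with two indices; array names are constants of the program.
  Programs are independent of the input and of [R].  Two restrictions make unit
  cost meaningful:
  - integers are only added and subtracted (truncated at 0), so that they have
    at most O(t) more bits after t steps than initially;
  - real computation is limited to the field operations and comparisons,
    starting from the input and the constants 0 and 1: there is neither a floor
    function nor a built-in real parameter. *)

Inductive nexp :=
| NConst of nat
| NGet of nat & nexp & nexp
| NAdd of nexp & nexp
| NSub of nexp & nexp.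

Inductive rexp :=
| RZero
| ROne
| RGet of nat & nexp & nexp
| RAdd of rexp & rexp
| RSub of rexp & rexp
| RMul of rexp & rexp
| RDiv of rexp & rexp.

Inductive bexp :=
| NLe of nexp & nexp
| RLe of rexp & rexp
| BNot of bexp
| BAnd of bexp & bexp.

Inductive cmd :=
| Skip
| NSet of nat & nexp & nexp & nexp  (* a[i, j] := e *)
| RSet of nat & nexp & nexp & rexp
| Seq of cmd & cmd
| If of bexp & cmd & cmd
| While of bexp & cmd.

Record state (R : realType) := State {
  nmem : nat -> nat -> nat -> nat;
  rmem : nat -> nat -> nat -> R
}.

Definition upd (T : Type) (m : nat -> nat -> nat -> T) (a i j : nat) (x : T) :=
  fun a' i' j' => if [&& a' == a, i' == i & j' == j] then x else m a' i' j'.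

Section Semantics.
Variable R : realType.
Implicit Types s : state R.

Fixpoint neval s (e : nexp) : nat :=
  match e with
  | NConst n => n
  | NGet a i j => nmem s a (neval s i) (neval s j)
  | NAdd e1 e2 => (neval s e1 + neval s e2)%N
  | NSub e1 e2 => (neval s e1 - neval s e2)%N
  end.

Fixpoint reval s (e : rexp) : R :=
  match e with
  | RZero => 0
  | ROne => 1
  | RGet a i j => rmem s a (neval s i) (neval s j)
  | RAdd e1 e2 => reval s e1 + reval s e2
  | RSub e1 e2 => reval s e1 - reval s e2
  | RMul e1 e2 => reval s e1 * reval s e2
  | RDiv e1 e2 => reval s e1 / reval s e2
  end.

Fixpoint beval s (b : bexp) : bool :=
  match b with
  | NLe e1 e2 => (neval s e1 <= neval s e2)%N
  | RLe e1 e2 => reval s e1 <= reval s e2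
  | BNot b1 => ~~ beval s b1
  | BAnd b1 b2 => beval s b1 && beval s b2
  end.

(* [exec P s t s']: started in s, the program P halts in s' after t steps.
   A step is one assignment or one test; the expressions involved belong to the
   text of P, so a step takes a number of elementary operations that is bounded
   in terms of P alone. *)
Inductive exec : cmd -> state R -> nat -> state R -> Prop :=
| exec_skip s : exec Skip s 1 s
| exec_nset a i j e s :
    exec (NSet a i j e) s 1
      (State (upd (nmem s) a (neval s i) (neval s j) (neval s e)) (rmem s))
| exec_rset a i j e s :
    exec (RSet a i j e) s 1
      (State (nmem s) (upd (rmem s) a (neval s i) (neval s j) (reval s e)))
| exec_seq P1 P2 s1 s2 s3 t1 t2 :
    exec P1 s1 t1 s2 -> exec P2 s2 t2 s3 -> exec (Seq P1 P2) s1 (t1 + t2) s3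
| exec_if b P1 P2 s t s' :
    exec (if beval s b then P1 else P2) s t s' -> exec (If b P1 P2) s t.+1 s'
| exec_while_false b P s :
    ~~ beval s b -> exec (While b P) s 1 s
| exec_while_true b P s1 s2 s3 t1 t2 :
    beval s1 b -> exec P s1 t1 s2 -> exec (While b P) s2 t2 s3 ->
    exec (While b P) s1 (t1 + t2).+1 s3.

(* Integer cell 0[0, 0] holds the number of vertices, integer array 1 the
   adjacency matrix, and real cell 0[v, 0] the capacity of v. *)
Definition input (G : sgraph) (cap : vertex G -> R) : state R :=
  State
    (fun a i j =>
       match a with
       | 0%N => if (i == 0%N) && (j == 0%N) then gorder G else 0%N
       | 1%N => match insub i, insub j with
                | Some u, Some v => nat_of_bool (@adj G u v)
                | _, _ => 0%N
                end
       | _ => 0%N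
       end)
    (fun a i j =>
       match a, j with
       | 0%N, 0%N => if insub i is Some v then cap v else 0
       | _, _ => 0
       end).

(* The packing is read off as follows: integer cell 2[0, 0] holds the number of
   sets, the i-th set consists of the v with integer cell 3[i, v] nonzero, and
   real cell 1[i, 0] holds its weight.  As memory is initially 0, a nonempty
   i-th set must have been written explicitly. *)
Definition output (G : sgraph) (s : state R) : seq ({set vertex G} * R) :=
  [seq ([set v : vertex G | nmem s 3 i (nat_of_ord v) != 0%N], rmem s 1 i 0)
     | i <- iota 0 (nmem s 2 0 0)].

End Semantics.

(* Main.v *)
(* A capacitated version of the greedy connected dominating set is used as the
   oracle of a multiplicative-weights packing.

   A family excluding K_h is d-degenerate together with all its minors
   (d = 2^(h+1), Mader), so that every minor has an orientation of outdegree at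
   most d.  Let k be the least capacity of a separator and let w be positive node
   weights of total cost sum_v cap v * w v = S.  Take all nodes of capacity
   greater than t = k / (2 (d + 1)); let every node add the cheapest member of
   its closed neighbourhood; then, as in Kruskal's algorithm, repeatedly add the
   cheapest pair of adjacent nodes that lie in different classes.  A set
   with light boundary nodes has a boundary of capacity at least k, at most half
   of which is reached by edges leaving the set, so that at least k / 2 of it
   lies on edges entering the set; since every node has at most d outgoing edges,
   charging the cost of each step to these edges bounds k * w(D) by (8 d + 2) S.
   The value of t is not known to the program, which tries every node capacity
   and 0 as a threshold and keeps the cheapest set.

   With w = p / cap, where the potentials p are multiplied by 1 + alpha / cap on
   the set chosen in each of 4 n^2 rounds, the sum of the potentials is at most
   n exp (C A / k) for a total weight A of the chosen sets, whereas the load a of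
   a node satisfies exp (a / 2) <= p; dividing the weights by the maximal load
   gives a packing of size at least k / (4 C). *)

Require Import Defs.
From mathcomp Require Import all_boot all_order all_algebra.
From mathcomp Require Import reals.
From mathcomp Require Import boolp sequences exp.
From mathcomp Require Import lra ring zify.

Set Implicit Arguments.
Unset Strict Implicit.
Unset Printing Implicit Defensive.

Import Order.TTheory GRing.Theory Num.Theory.
Local Open Scope ring_scope.

(** * Connectivity and boundaries *)

Section Connectivity.
Variable G : sgraph.
Implicit Types (A B S : {set vertex G}) (x y u v : vertex G).

Lemma induced_sym A : connect_sym (induced_adj A).
Proof.
apply: sym_connect_sym => x y; rewrite /induced_adj /= adj_sym.
by rewrite andbA [(_ \in _) && _]andbC -andbA.
Qed.

Lemma connect_in A x y : connect (induced_adj A) x y -> x \in A -> y \in A.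
Proof.
move=> /connectP[p pP ->]; elim: p x pP => [|z p IHp] x //=.
by case/andP=> /and3P[_ zA _] zp _; apply: IHp zp zA.
Qed.

Lemma connect_induced_sub A B x y : A \subset B ->
  connect (induced_adj A) x y -> connect (induced_adj B) x y.
Proof.
move=> /subsetP AB; apply: connect_sub => u v /and3P[uA vA uv].
by apply: connect1; rewrite /induced_adj /= !AB.
Qed.

Lemma connected_setP A :
  reflect ((exists x, x \in A) /\
           {in A &, forall x y, connect (induced_adj A) x y})
          (connected_set A).
Proof.
have sA := induced_sym A.
have clA : closed (induced_adj A) A by move=> x y /and3P[-> ->].
have rootA x : x \in A -> fingraph.root (induced_adj A) x \in A.
  by move=> xA; rewrite -(closed_connect clA (connect_root _ x)).
apply: (iffP idP) => [/eqP n1|[[x xA] cA]].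
  have [r rP] : {r | [predI roots (induced_adj A) & A] =i pred1 r}.
    exact: mem_card1.
  have eqr x : x \in A -> fingraph.root (induced_adj A) x = r.
    move=> xA; apply/eqP; rewrite -[_ == _]/(_ \in pred1 r) -rP inE /=.
    by rewrite [X in X && _](roots_root sA) rootA.
  split.
    exists r; have : r \in pred1 r by rewrite inE.
    by rewrite -rP => /andP[].
  by move=> x y xA yA; rewrite -(root_connect sA) !eqr.
rewrite /connected_set /num_components -(n_comp_connect sA x).
apply/eqP/eq_n_comp_r => y.
by apply/idP/idP => [/(cA _ _ xA)|/connect_in]; last exact.
Qed.

Lemma connected_set1 x : connected_set [set x].
Proof.
apply/connected_setP; split; first by exists x; rewrite inE.
by move=> u v; rewrite !inE => /eqP-> /eqP->.
Qed.

Lemma connected_setU A B u v : connected_set A -> connected_set B ->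
  u \in A -> v \in B -> adj u v -> connected_set (A :|: B).
Proof.
move=> /connected_setP[_ cA] /connected_setP[_ cB] uA vB uv.
have cAU x y : x \in A -> y \in A -> connect (induced_adj (A :|: B)) x y.
  by move=> xA yA; apply: connect_induced_sub (cA _ _ xA yA); apply: subsetUl.
have cBU x y : x \in B -> y \in B -> connect (induced_adj (A :|: B)) x y.
  by move=> xA yA; apply: connect_induced_sub (cB _ _ xA yA); apply: subsetUr.
have cuv : connect (induced_adj (A :|: B)) u v.
  by apply: connect1; rewrite /induced_adj /= !inE uA vB orbT.
apply/connected_setP; split; first by exists u; rewrite inE uA.
have to_u x : x \in A :|: B -> connect (induced_adj (A :|: B)) x u.
  case/setUP=> [xA|xB]; first exact: cAU.
  by apply: connect_trans (cBU _ _ xB vB) _; rewrite induced_sym.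
move=> x y xU yU; apply: connect_trans (to_u _ xU) _.
by rewrite induced_sym to_u.
Qed.

Definition component A x := [set y in A | connect (induced_adj A) x y].

Lemma component_connected A x : x \in A -> connected_set (component A x).
Proof.
move=> xA; have cxP y : y \in component A x ->
    connect (induced_adj (component A x)) x y.
  rewrite inE => /andP[yA /connectP[p pP def_y]].
  elim/last_ind: p y yA pP def_y => [|p z IHp] y yA; first by move=> _ ->.
  rewrite rcons_path last_rcons => /andP[pP /and3P[lA zA lz]] ->.
  have xl : connect (induced_adj A) x (last x p) by apply/connectP; exists p.
  apply: connect_trans (IHp _ lA pP erefl) (connect1 _).
  rewrite /induced_adj /= !inE lA zA lz xl /= andbT.
  by apply: connect_trans xl (connect1 _); apply/and3P.
apply/connected_setP; split; first by exists x; rewrite inE xA connect0.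
move=> y z yc zc; apply: connect_trans (cxP _ zc).
by rewrite induced_sym cxP.
Qed.

Lemma node_separatorI S x y : x \notin S -> y \notin S ->
  ~~ connect (induced_adj (~: S)) x y -> node_separator S.
Proof.
move=> xS yS nxy; rewrite /node_separator ltnNge; apply: contra nxy => le1.
have sA := induced_sym (~: S).
have clA : closed (induced_adj (~: S)) (~: S) by move=> u v /and3P[-> ->].
have rootA u : u \notin S -> fingraph.root (induced_adj (~: S)) u \in ~: S.
  by move=> uA; rewrite -(closed_connect clA (connect_root _ u)) inE.
rewrite -(root_connect sA).
move: le1 => /card_le1P le1.
have /le1 :
    fingraph.root (induced_adj (~: S)) x
      \in [predI roots (induced_adj (~: S)) & ~: S].
  by rewrite inE /= [X in X && _](roots_root sA) rootA.
move=> /(_ (fingraph.root (induced_adj (~: S)) y)) /[!inE] /=.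
by rewrite [X in X && _](roots_root sA) -in_setC rootA // eq_sym => /esym.
Qed.

Definition boundary A := [set y | (y \notin A) && [exists x in A, adj x y]].

(** No edge leaves [A] once its boundary is deleted, so [x] and [y] end up in different
    components. *)
Lemma boundary_separator A x y : x \in A -> y \notin A -> y \notin boundary A ->
  node_separator (boundary A).
Proof.
move=> xA yA yB; apply: (@node_separatorI _ x y) => //; first by rewrite inE xA.
suff cl : closed (induced_adj (~: boundary A)) A.
  by apply/negP => /(closed_connect cl); rewrite xA (negbTE yA).
suff half u v : induced_adj (~: boundary A) u v -> u \in A -> v \in A.
  move=> u v uv; apply/idP/idP; first exact: half.
  by apply: half; move: uv; rewrite /induced_adj /= adj_sym => /and3P[-> ->].
rewrite /induced_adj /= !inE => /and3P[_ vB uv] uA; apply: contraR vB => vA.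
by rewrite vA; apply/existsP; exists u; rewrite uA.
Qed.

End Connectivity.

(** * Families of branch sets *)

Section CountEdges.
Variables (T : finType) (e : rel T).
Hypotheses (e_sym : symmetric e) (e_irr : irreflexive e).
Implicit Types P Q : {set T}.
Local Open Scope nat_scope.

Definition degree P x := \sum_(y in P) e x y.

(** For symmetric irreflexive [e] each edge inside [P] is counted from both ends, which keeps the
    density condition free of halves. *)
Definition double_edges P := \sum_(x in P) degree P x.

Lemma degree_setU1 P x z : z \notin P -> degree (z |: P) x = e x z + degree P x.
Proof. exact: big_setU1. Qed.

Lemma double_edges_setU1 P z : z \notin P ->
  double_edges (z |: P) = double_edges P + 2 * degree P z.
Proof.
move=> zP; rewrite /double_edges big_setU1 //= degree_setU1 // e_irr add0n.
rewrite (eq_bigr (fun x => e x z + degree P x)); last first.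
  by move=> x _; rewrite degree_setU1.
rewrite big_split /= (eq_bigr (fun x => nat_of_bool (e z x))); last first.
  by move=> x _; rewrite e_sym.
by rewrite -/(degree P z) -/(double_edges P); lia.
Qed.

(** Contracting the edge between [x] and [y] to [z] loses that edge and identifies two edges at
    every common neighbour; each loss counts twice. *)
Lemma double_edges_contract Q x y z : x \notin y |: Q -> y \notin Q ->
    z \notin Q -> e x y -> {in Q, forall u, e z u = e x u || e y u} ->
  double_edges (x |: (y |: Q)) =
    double_edges (z |: Q) + 2 + 2 * \sum_(u in Q) (e x u && e y u).
Proof.
move=> xQ yQ zQ exy ez; rewrite !double_edges_setU1 // degree_setU1 // exy.
suff : degree Q z + \sum_(u in Q) (e x u && e y u) = degree Q x + degree Q y.
  by move: (degree Q x) (degree Q y) (degree Q z) (double_edges Q) (\sum_(u in Q) _); lia.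
rewrite /degree -!big_split /=; apply: eq_bigr => u /ez ->.
by case: (e x u); case: (e y u).
Qed.

End CountEdges.

Section Families.
Variable G : sgraph.
Implicit Types (A B X Y Z : {set vertex G}) (P Q : {set {set vertex G}}).

Definition touch A B := [exists u in A, exists v in B, adj u v].

Lemma touchP A B :
  reflect (exists u v, [/\ u \in A, v \in B & adj u v]) (touch A B).
Proof.
apply: (iffP existsP) => [[u /andP[uA /existsP[v /andP[vB uv]]]]|].
  by exists u, v.
by case=> u [v [uA vB uv]]; exists u; rewrite uA; apply/existsP; exists v; rewrite vB.
Qed.

Lemma touch_sym A B : touch A B = touch B A.
Proof.
by apply/touchP/touchP => -[u [v [? ? ?]]]; exists v, u; rewrite adj_sym.
Qed.

Lemma touchS A A' B B' : A \subset A' -> B \subset B' -> touch A B -> touch A' B'.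
Proof.
move=> /subsetP sA /subsetP sB /touchP[u [v [uA vB uv]]]; apply/touchP.
by exists u, v; split; [apply: sA|apply: sB|].
Qed.

Lemma touchUl A B Z : touch (A :|: B) Z = touch A Z || touch B Z.
Proof.
apply/idP/orP => [/touchP[u [v [/setUP[uA|uB] vZ uv]]]|].
- by left; apply/touchP; exists u, v.
- by right; apply/touchP; exists u, v.
by case; apply: touchS => //; [apply: subsetUl|apply: subsetUr].
Qed.

(** Adjacency in the minor whose vertices are branch sets; a branch set may touch itself, hence the
    condition [A != B]. *)
Definition near A B := (A != B) && touch A B.

Lemma near_sym : symmetric near.
Proof. by move=> A B; rewrite /near eq_sym touch_sym. Qed.

Lemma near_irr : irreflexive near.
Proof. by move=> A; rewrite /near eqxx. Qed.

(** A set of branch sets stands for the minor it spans, so that contraction and deletion never build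
    a new graph. *)
Definition branch_family P :=
  {in P, forall A, connected_set A} /\
  {in P &, forall A B, A != B -> [disjoint A & B]}.

Lemma branch_familyS P Q : Q \subset P -> branch_family P -> branch_family Q.
Proof.
move=> /subsetP QP [cP dP]; split=> [A /QP /cP //|A B /QP AP /QP BP].
exact: dP.
Qed.

Lemma connected_set_neq0 A : connected_set A -> A != set0.
Proof. by case/connected_setP => [[x xA] _]; apply/set0Pn; exists x. Qed.

Lemma disjoint_neq A B : A != set0 -> [disjoint A & B] -> A != B.
Proof.
by move=> A0 dAB; apply: contraNneq A0 => eqAB; rewrite -setI_eq0 -eqAB setIid in dAB.
Qed.

Lemma branch_family_setU1 Z P : connected_set Z ->
  {in P, forall A, [disjoint Z & A]} -> branch_family P -> branch_family (Z |: P).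
Proof.
move=> cZ dZ [cP dP]; split=> [A /setU1P[-> //|/cP //]|].
move=> A B /setU1P[->|AP] /setU1P[->|BP]; rewrite ?eqxx // => AB.
- exact: dZ.
- by rewrite disjoint_sym dZ.
- exact: dP.
Qed.

(** A complete minor of the minor [P]. The last two clauses allow adding one more branch set: if it
    is disjoint from all members of [P] it is disjoint from those of [Q], and if it touches all
    members of [P] it touches those of [Q]. *)
Definition clique_model P Q :=
  [/\ branch_family Q, {in Q &, forall A B, A != B -> touch A B},
      {in Q, forall Z, Z \subset cover P}
    & {in Q, forall Z, exists2 A, A \in P & A \subset Z}].

Lemma clique_model_refine P P' Q :
    cover P' \subset cover P ->
    {in P', forall A', exists2 A, A \in P & A \subset A'} ->
  clique_model P' Q -> clique_model P Q.
Proof.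
move=> sc sP [bQ tQ cQ mQ]; split=> // Z ZQ.
  exact: subset_trans (cQ _ ZQ) sc.
have [A' /sP[A AP AA'] A'Z] := mQ _ ZQ; exists A => //.
exact: subset_trans AA' A'Z.
Qed.

Lemma cover_disjoint P X : {in P, forall A, [disjoint X & A]} -> [disjoint X & cover P].
Proof.
move=> dX; rewrite disjoint_subset; apply/subsetP => x xX.
by apply/bigcupP => -[A AP xA]; move: (disjointFr (dX _ AP) xX); rewrite xA.
Qed.

(* Mader: in a family that is minimal with respect to merging and deleting,
   each member has many common neighbours with each of its neighbours, so that
   its neighbourhood is dense again and the induction on r applies to it. *)
Lemma mader r P : branch_family P -> P != set0 ->
    (2 ^ r.+1 * #|P| <= double_edges near P)%N ->
  exists2 Q, clique_model P Q & #|Q| = r.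
Proof.
elim: r P => [|r IHr] P.
  move=> _ _ _; exists set0; last by rewrite cards0.
  by split=> [|A B|Z|Z]; rewrite ?inE //; split=> [A|A B]; rewrite inE.
have [m] := ubnP #|P|; elim: m P => // m IHm P /ltnSE leP bP P0 dense.
have [cP dP] := bP.
have [X XP] := set0Pn _ P0.
have sub_refine P' Q : P' \subset P -> clique_model P' Q -> clique_model P Q.
  move=> /subsetP sP; apply: clique_model_refine => [|A AP'].
    by apply/subsetP => x /bigcupP[A /sP AP xA]; apply/bigcupP; exists A.
  by exists A => //; apply: sP.
have PX : P = X |: (P :\ X) by rewrite setD1K.
have XnP : X \notin P :\ X by rewrite !inE eqxx.
have [isolated|] := boolP [forall Y in P, ~~ near X Y].
  have dX : degree near (P :\ X) X = 0%N.
    apply: big1 => Y /setD1P[_ YP].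
    by move/forall_inP: isolated => /(_ _ YP) /negbTE ->.
  move: dense; rewrite {2}PX (double_edges_setU1 near_sym near_irr) // dX muln0 addn0.
  rewrite {1}PX cardsU1 XnP mulnDr muln1 => dense.
  have P'0 : P :\ X != set0.
    apply: contraL dense => /eqP ->; rewrite /double_edges big_set0 -ltnNge.
    by rewrite cards0 muln0 addn0 expn_gt0.
  have [] := IHm _ _ _ P'0 _.
  - by rewrite (cardsD1 X) XP in leP.
  - by apply: branch_familyS bP; apply: subD1set.
  - exact: leq_trans (leq_addl _ _) dense.
  move=> Q mQ cardQ; exists Q => //; apply: sub_refine mQ; exact: subD1set.
rewrite negb_forall => /existsP[Y0]; rewrite negb_imply negbK => /andP[Y0P XY0].
pose N := [set Y in P | near X Y].
have sNP : N \subset P by apply/subsetP => Y /setIdP[].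
pose common Y := (\sum_(B in N) near Y B)%N.
have [/exists_inP[Y /setIdP[YP XY] few]|many] :=
    boolP [exists Y in N, (common Y).+1 <= 2 ^ r.+1]%N; last first.
  have bN := branch_familyS sNP bP.
  have N0 : N != set0 by apply/set0Pn; exists Y0; rewrite inE Y0P.
  have [|Q [bQ tQ cQ mQ] cardQ] := IHr N bN N0.
    rewrite mulnC -sum_nat_const leq_sum // => Y YN.
    move: many; rewrite negb_exists_in => /forall_inP/(_ _ YN).
    by rewrite -ltnNge ltnS.
  have dXN : {in N, forall A, [disjoint X & A]}.
    by move=> A /setIdP[AP /andP[XA _]]; apply: dP.
  have dXQ : {in Q, forall A, [disjoint X & A]}.
    move=> A /cQ AN; rewrite disjoint_sym; apply: disjointWl AN _.
    by rewrite disjoint_sym cover_disjoint.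
  have tXQ : {in Q, forall A, touch X A}.
    by move=> A /mQ[B /setIdP[_ /andP[_]] tXB BA]; apply: touchS tXB.
  have XQ : X \notin Q.
    apply/negP => /dXQ /(disjoint_neq (connected_set_neq0 (cP _ XP))).
    by rewrite eqxx.
  exists (X |: Q); last by rewrite cardsU1 XQ cardQ.
  split=> [|A B|A|A].
  - by apply: branch_family_setU1 => //; apply: cP.
  - move=> /setU1P[->|AQ] /setU1P[->|BQ]; rewrite ?eqxx // => AB.
    + exact: tXQ.
    + by rewrite touch_sym tXQ.
    + exact: tQ.
  - case/setU1P => [->|AQ]; first exact: bigcup_sup.
    apply: subset_trans (cQ _ AQ) _.
    by apply/subsetP => x /bigcupP[B /(subsetP sNP) BP xB]; apply/bigcupP; exists B.
  - case/setU1P => [->|/mQ[B /(subsetP sNP) BP BA]]; first by exists X.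
    by exists B.
have [XneY tXY] := andP XY.
pose R := P :\ X :\ Y; pose Z := X :|: Y.
have RP B : B \in R -> [/\ B \in P, B != X & B != Y].
  by rewrite !inE => /and3P[].
have YPX : Y \in P :\ X by rewrite !inE eq_sym XneY.
have defP : P = X |: (Y |: R) by rewrite /R setD1K.
have YR : Y \notin R by rewrite !inE eqxx.
have XYR : X \notin Y |: R by rewrite /R setD1K.
have [u [v [uX vY uv]]] := touchP _ _ tXY.
have cZ : connected_set Z by apply: connected_setU uX vY uv; apply: cP.
have dZR : {in R, forall B, [disjoint Z & B]}.
  move=> B /RP[BP BX BY]; rewrite -setI_eq0 setIUl setU_eq0 !setI_eq0.
  by rewrite !dP // eq_sym.
have ZR : Z \notin R.
  by apply/negP => /dZR /(disjoint_neq (connected_set_neq0 cZ)); rewrite eqxx.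
have eZ : {in R, forall B, near Z B = near X B || near Y B}.
  move=> B BR; have [BP BX BY] := RP _ BR; rewrite /near touchUl.
  rewrite (disjoint_neq (connected_set_neq0 cZ) (dZR _ BR)).
  by rewrite ![_ == B]eq_sym BX BY.
have := double_edges_contract near_sym near_irr XYR YR ZR XY eZ.
rewrite -defP => countP.
have cardP : #|P| = #|R|.+2 by rewrite defP !cardsU1 XYR YR.
have few' : (\sum_(B in R) (near X B && near Y B) <= common Y)%N.
  rewrite /common big_mkcond [leqRHS]big_mkcond leq_sum // => B _.
  rewrite [B \in N]inE; case: ifP => [/RP[-> _ _]|//] /=.
  by case: (near X B).
have sR : R \subset P by apply/subsetP => B /RP[].
(* Contraction lowers [double_edges] by at most [2 + 2 * common Y <= 2 ^ r.+2], which is exactly the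
   share of the one member lost. *)
have [||||Q mQ cardQ] := IHm (Z |: R).
- by rewrite cardsU1 ZR -ltnS -cardP.
- by apply: branch_family_setU1 => //; apply: branch_familyS bP.
- by apply/set0Pn; exists Z; rewrite setU11.
- move: dense; rewrite countP cardsU1 ZR cardP; move: few few'.
  rewrite add1n [(_ * _.+2)%N]mulnS {1}[(2 ^ r.+2)%N]expnS.
  move: (_ * _.+1)%N (2 ^ r.+1)%N (common Y) (\sum_(_ in R) _)%N (double_edges _ _).
  by clear; lia.
exists Q => //; apply: clique_model_refine mQ.
  rewrite /cover bigcup_setU big_set1 subUset; apply/andP; split.
    by rewrite subUset !bigcup_sup.
  by apply/subsetP => x /bigcupP[B /(subsetP sR) BP xB]; apply/bigcupP; exists B.
move=> A /setU1P[->|/(subsetP sR) AP]; last by exists A.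
by exists X; rewrite ?subsetUl.
Qed.

End Families.

(** * Orientations of bounded outdegree and capacities of boundaries *)

Section Orientation.
Variable G : sgraph.
Implicit Types (A B X Y Z : {set vertex G}) (P Q : {set {set vertex G}}).

Definition excludes_clique r :=
  forall Q, branch_family Q -> {in Q &, forall A B, A != B -> touch A B} ->
  #|Q| != r.

Lemma exists_low_degree r P : excludes_clique r -> branch_family P ->
  P != set0 -> exists2 X, X \in P & (degree (@near G) P X < 2 ^ r.+1)%N.
Proof.
move=> noK bP P0; apply/exists_inP; apply: contraPT isT => high.
have [|Q [bQ tQ _ _] cardQ] := mader (r := r) bP P0.
  rewrite mulnC -sum_nat_const leq_sum // => X XP.
  move: high; rewrite negb_exists_in => /forall_inP/(_ _ XP).
  by rewrite -leqNgt.
by have := noK _ bQ tQ; rewrite cardQ eqxx.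
Qed.

(** Degeneracy: remove a member of degree below [2 ^ r.+1], direct its edges away from it, and
    orient the rest by induction. *)
Lemma exists_orientation r P : excludes_clique r -> branch_family P ->
  exists o : rel {set vertex G},
    {in P &, forall A B, near A B -> o A B || o B A} /\
    {in P, forall A, #|[set B in P | o A B]| <= 2 ^ r.+1}%N.
Proof.
move=> noK; have [m] := ubnP #|P|; elim: m P => // m IHm P /ltnSE leP bP.
have [->|P0] := eqVneq P set0.
  by exists (fun _ _ => false); split=> [A B|A]; rewrite inE.
have [X XP degX] := exists_low_degree noK bP P0.
have [||o [tot out]] := IHm (P :\ X).
- by rewrite (cardsD1 X) XP in leP.
- by apply: branch_familyS bP; apply: subD1set.
exists (fun A B => if A == X then near X B else (B != X) && o A B); split.
  move=> A B AP BP AB; case: (eqVneq A X) => [<-|AX]; first by rewrite AB.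
  case: (eqVneq B X) => [<-|BX] /=; first by rewrite near_sym AB.
  by apply: tot => //; rewrite !inE ?AX ?BX.
move=> A AP; case: (eqVneq A X) => [_|AX].
  apply: leq_trans (ltnW degX); rewrite /degree -sum1_card big_mkcond.
  rewrite [leqRHS]big_mkcond leq_sum // => B _; rewrite inE.
  by case: (B \in P) => //=; case: (near X B).
have AP' : A \in P :\ X by rewrite !inE AX.
apply: leq_trans (out _ AP'); apply: subset_leq_card; apply/subsetP => B.
by rewrite !inE => /and3P[-> -> ->].
Qed.

Lemma branch_family_singletons (S : {set vertex G}) :
  branch_family [set [set x] | x in S].
Proof.
split=> [A /imsetP[x _ ->]|A B /imsetP[x _ ->] /imsetP[y _ ->] xy].
  exact: connected_set1.
by rewrite disjoints1 !inE; apply: contraNneq xy => ->.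
Qed.

Variables (R : realType) (cap : vertex G -> R).
Hypothesis cap_ge0 : forall v, 0 <= cap v.

(** A boundary vertex not directed to [X] receives an edge from [X]; there are at most [d] of these,
    each of capacity at most [t]. *)
Lemma boundary_in_heavy d t (o : rel {set vertex G}) P X : X \in P ->
    {in P &, forall A B, near A B -> o A B || o B A} ->
    (#|[set B in P | o X B]| <= d)%N -> 0 <= t ->
    {in boundary X, forall x, [set x] \in P /\ cap x <= t} ->
  capacity cap (boundary X) <=
    \sum_(x in boundary X | o [set x] X) cap x + d%:R * t.
Proof.
move=> XP tot out t0 bdP; rewrite /capacity (bigID (fun x => o [set x] X)) /=.
rewrite lerD2l.
apply: (@le_trans _ _ (\sum_(x in boundary X | ~~ o [set x] X) t)).
  by apply: ler_sum => x /andP[/bdP[]].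
rewrite sumr_const -[leLHS]mulr_natl ler_wpM2r // ler_nat; apply: leq_trans out.
rewrite -(card_imset _ (@set1_inj _)); apply: subset_leq_card.
apply/subsetP => B /imsetP[x /andP[xX xnX] ->]; have [xP _] := bdP _ xX.
rewrite inE xP /=; have := tot X [set x] XP xP; rewrite (negbTE xnX) orbF.
apply; move: xX; rewrite inE => /andP[xX /existsP[u /andP[uX ux]]].
apply/andP; split; first by apply: contraNneq xX => ->; rewrite inE.
by apply/touchP; exists u, x; rewrite inE.
Qed.

Lemma exists_vertex_orientation r : excludes_clique r ->
  exists o : rel (vertex G),
    (forall x y, adj x y -> o x y || o y x) /\
    (forall x, #|[set y | o x y]| <= 2 ^ r.+1)%N.
Proof.
move=> noK; have [o [tot out]] :=
  exists_orientation noK (branch_family_singletons setT).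
have inP x : [set x] \in [set [set x] | x in [set: vertex G]].
  by apply: imset_f; rewrite inE.
exists (fun x y => o [set x] [set y]); split=> [x y xy|x].
  apply: tot => //; apply/andP; split.
    by apply: contraTneq xy => /set1_inj ->; rewrite adj_irrefl.
  by apply/touchP; exists x, y; rewrite !inE.
apply: leq_trans (out _ (inP x)); rewrite -(card_imset _ (@set1_inj _)).
apply: subset_leq_card; apply/subsetP => B /imsetP[y]; rewrite inE => oxy ->.
by rewrite inE inP.
Qed.

(** The neighbourhood of [v] has capacity at least [k - t]: either it is a separator, or [v] is
    adjacent to all other vertices and its closed neighbourhood contains a minimum separator.
    Out-neighbours take at most [d%:R * t] of it, which leaves at least half of [k] for the
    in-neighbours. *)
Lemma light_in_heavy d t k (o : rel (vertex G)) v :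
    (forall x y, adj x y -> o x y || o y x) ->
    (forall x, #|[set y | o x y]| <= d)%N ->
    min_separator_capacity cap k -> 0 <= t -> k = (d.+1)%:R * t *+ 2 ->
    cap v <= t -> (forall u, adj v u -> cap u <= t) ->
  k <= (\sum_(u | adj v u && o u v) cap u) *+ 2.
Proof.
move=> tot out [[S [_ capS]] min_k] t0 kt vt ut.
have bdE u : (u \in boundary [set v]) = adj v u.
  rewrite !inE; apply/andP/idP => [[_ /existsP[w /andP[]]]|vu].
    by rewrite inE => /eqP->.
  split; first by apply: contraTneq vu => ->; rewrite adj_irrefl.
  by apply/existsP; exists v; rewrite inE eqxx.
have large : k - t <= capacity cap (boundary [set v]).
  have [/existsP[y /andP[yv yb]]|all_nbr] :=
      boolP [exists y, (y != v) && (y \notin boundary [set v])].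
    apply: (@le_trans _ _ k); first by rewrite lerBlDr lerDl.
    apply: min_k; apply: (@boundary_separator _ _ v y) => //; by rewrite ?inE.
  rewrite -capS lerBlDr.
  apply: (@le_trans _ _ (capacity cap (boundary [set v]) + cap v)); last by rewrite lerD2l.
  rewrite addrC /capacity -(@big_setU1 _ _ _ _ v (boundary [set v]) cap) /=; last first.
    by rewrite bdE adj_irrefl.
  rewrite [leLHS]big_mkcond [leRHS]big_mkcond ler_sum // => u _.
  have -> : u \in v |: boundary [set v].
    rewrite in_setU1; move: all_nbr; rewrite negb_exists => /forallP/(_ u).
    by rewrite negb_and !negbK.
  by case: ifP.
have outv : (\sum_(u in boundary [set v] | ~~ o u v) cap u) <= d%:R * t.
  apply: (@le_trans _ _ (\sum_(u in boundary [set v] | ~~ o u v) t)).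
    by apply: ler_sum => u; rewrite bdE => /andP[/ut].
  rewrite sumr_const -[leLHS]mulr_natl ler_wpM2r // ler_nat.
  apply: leq_trans (out v); apply: subset_leq_card; apply/subsetP => u.
  rewrite -topredE /= bdE => /andP[/tot + ouv].
  by rewrite (negbTE ouv) orbF inE.
move: large; rewrite /capacity (bigID (fun u => o u v)) /=.
rewrite (eq_bigl (fun u => adj v u && o u v)); last by move=> u; rewrite bdE.
rewrite kt -natr1; move: outv; lra.
Qed.

(** Take as branch sets the components of [H] that meet [U] and the single vertices outside [H]. The
    boundary of such a component separates it from another one, so vertices of capacity at least
    [k / 2] are directed to it; each vertex outside [H] is directed to at most [2 ^ r.+1] branch
    sets, and double counting gives the bound. *)
Lemma separated_count r t k (H U : {set vertex G}) :
    excludes_clique r -> min_separator_capacity cap k ->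
    0 <= t -> k = (2 ^ r.+1).+1%:R * t *+ 2 ->
    (forall x, x \notin H -> cap x <= t) ->
    U \subset H -> (1 < #|U|)%N ->
    {in U &, forall x y, connect (induced_adj H) x y -> x = y} ->
  k * #|U|%:R <= (2 ^ r.+1)%:R * (\sum_(x in ~: H) cap x) *+ 2.
Proof.
move=> noK [_ min_k] t0 kt lightH /subsetP UH U2 sepU.
pose K := [set component H x | x in U].
pose P := K :|: [set [set x] | x in ~: H].
have compH x : component H x \subset H by apply/subsetP => y /setIdP[].
have injK : {in U &, injective (component H)}.
  move=> x y xU yU eq_xy; apply: sepU => //.
  have : y \in component H x by rewrite eq_xy inE connect0 UH.
  by rewrite inE => /andP[].
have cardK : #|K| = #|U| by apply: card_in_imset.
have [cS dS] := branch_family_singletons (~: H).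
have dKS x y : y \in ~: H -> [disjoint component H x & [set y]].
  rewrite disjoint_sym disjoints1 !inE => yH; apply: contra yH.
  by case/andP.
have bP : branch_family P.
  split=> [A /setUP[/imsetP[x /UH xH ->]|/cS //]|A B].
    exact: component_connected.
  move=> /setUP[/imsetP[x xU ->]|AS] /setUP[/imsetP[y yU ->]|BS].
  - rewrite -setI_eq0 => neq; apply: contraNT neq => /set0Pn[z /setIP[]].
    rewrite !inE => /andP[_ xz] /andP[_ yz]; apply/eqP; congr component.
    by apply: sepU => //; apply: connect_trans xz _; rewrite induced_sym.
  - by move=> _; have /imsetP[z zH ->] := BS; apply: dKS.
  - by move=> _; rewrite disjoint_sym; have /imsetP[z zH ->] := AS; apply: dKS.
  - exact: dS.
have [o [tot out]] := exists_orientation noK bP.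
have bdH x y : x \in U -> y \in boundary (component H x) -> y \notin H.
  move=> /UH xH; rewrite inE => /andP[yC /existsP[u /andP[]]].
  rewrite inE => /andP[uH xu] uy; apply: contra yC => yH.
  rewrite inE yH; apply: connect_trans xu (connect1 _); exact/and3P.
have inP y : y \notin H -> [set y] \in P.
  by move=> yH; apply/setUP; right; apply: imset_f; rewrite inE.
have half X : X \in K -> k <= (\sum_(x in ~: H | o [set x] X) cap x) *+ 2.
  case/imsetP=> x xU ->; pose C := component H x.
  have CP : C \in P by apply/setUP; left; apply: imset_f.
  have [y yU yx] : exists2 y, y \in U & y != x.
    have /set0Pn[y /setD1P[yx yU]] : U :\ x != set0.
      by rewrite -card_gt0; move: U2; rewrite (cardsD1 x U) xU.
    by exists y.
  have : k <= capacity cap (boundary C).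
    apply: min_k; apply: (@boundary_separator _ C x y); first by rewrite inE UH /=.
      rewrite inE UH //=; apply: contra yx => xy; apply/eqP.
      by apply/esym/sepU.
    by apply/negP => /(bdH _ _ xU); rewrite UH.
  have bdP : {in boundary C, forall z, [set z] \in P /\ cap z <= t}.
    by move=> z /(bdH _ _ xU) zH; split; [apply: inP|apply: lightH].
  have := boundary_in_heavy CP tot (out _ CP) t0 bdP.
  have : \sum_(z in boundary C | o [set z] C) cap z <=
         \sum_(z in ~: H | o [set z] C) cap z.
    rewrite [leLHS]big_mkcond [leRHS]big_mkcond ler_sum // => z _.
    case: ifP => [/andP[/(bdH _ _ xU) zH ->]|_]; first by rewrite inE zH.
    by case: ifP.
  by rewrite kt -natr1 !mulr2n !mulrDl mul1r; lra.
rewrite -cardK mulr_natr -sumr_const.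
apply: le_trans (ler_sum _ half) _.
rewrite sumrMnl lerMn2r /= (exchange_big_dep (mem (~: H))) /=; last first.
  by move=> X x _ /andP[].
rewrite big_distrr /= ler_sum // => x; rewrite inE => xH.
rewrite sumr_const -[leLHS]mulr_natl ler_wpM2r // ler_nat.
apply: leq_trans (out _ (inP _ xH)); apply: subset_leq_card; apply/subsetP => X.
case/andP => XK /andP[_ oX].
by rewrite inE; apply/andP; split=> //; apply/setUP; left.
Qed.

End Orientation.

(** A complete model with as many branch sets as [H] has vertices contains [H] as a minor, under any
    numbering of the branch sets. *)
Lemma minor_excludes_clique (F : sgraph -> Prop) (G H : sgraph) :
  minor_closed F -> ~ F H -> F G -> excludes_clique G (gorder H).
Proof.
move=> cF nFH FG Q [cQ dQ] tQ; apply/eqP => cardQ; apply: nFH.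
apply: (cF G) => //.
pose B (x : vertex H) := enum_val (cast_ord (esym cardQ) x).
have BQ x : B x \in Q by apply: enum_valP.
have BI : injective B by move=> x y /enum_val_inj /cast_ord_inj.
exists B; split=> [x|x y xy|x y xy]; first exact: cQ.
  by apply: dQ => //; rewrite (inj_eq BI).
apply/touchP; apply: tQ => //; rewrite (inj_eq BI).
by apply: contraTneq xy => ->; rewrite adj_irrefl.
Qed.

(** * Cost of a connected dominating set *)

Lemma sum_ltS (V : nmodType) n (F : 'I_n -> V) (v : 'I_n) :
  \sum_(x < n | (x < v.+1)%N) F x = \sum_(x < n | (x < v)%N) F x + F v.
Proof.
rewrite (bigD1 v) //= addrC; congr (_ + _); apply: eq_bigl => x.
rewrite ltnS leq_eqVlt andbC -val_eqE /=.
by case: (ltngtP x v).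
Qed.

Section Oracle.
Variables (R : realType) (G : sgraph) (cap w : vertex G -> R).
Variables (d : nat) (o : rel (vertex G)).
Hypotheses (cap_ge0 : forall v, 0 <= cap v) (w_gt0 : forall v, 0 < w v).
Hypothesis o_total : forall x y, adj x y -> o x y || o y x.
Hypothesis o_out : forall x, (#|[set y | o x y]| <= d)%N.
Implicit Types (u v x y b : vertex G) (ww : vertex G -> R) (D U : {set vertex G}).

Definition cadj v u := (u == v) || adj v u.

(** [U] is the set of heavy vertices for the right value of [t]. The program knows neither [k] nor
    [t], so this is only a premise of the cost bounds, never of the validity of the set. *)
Definition threshold (k t : R) U :=
  [/\ min_separator_capacity cap k, 0 <= t, k = d.+1%:R * t *+ 2 &
      forall u, (u \in U) = (t < cap u)].

(** The current set is encoded by setting the weights of its members to 0; as [w] is positive,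
    [zeros ww] recovers it. Choosing a cheapest vertex then prefers members of the set. *)
Definition mask ww := forall u, ww u = 0 \/ ww u = w u.

Definition zeros ww : {set vertex G} := [set u | ww u == 0].

Lemma mask_sum ww : mask ww -> \sum_(u in zeros ww) w u = \sum_u (w u - ww u).
Proof.
move=> mw; rewrite big_mkcond; apply: eq_bigr => u _; rewrite inE.
case: eqP => [->|nz]; first by rewrite subr0.
by case: (mw u) => // ->; rewrite subrr.
Qed.

(** The weight of the current set, written as [\sum_u (w u - ww u)], is charged to the heavy
    vertices and to the edges entering the first [j] vertices. *)
Definition fill_inv U j ww :=
  [/\ mask ww, {in U, forall u, ww u = 0},
      forall v : 'I_(gorder G), (v < j)%N -> exists2 u, cadj v u & ww u = 0
    & forall k t, threshold k t U ->
        k * (\sum_u (w u - ww u)) <= k * (\sum_(u in U) w u) +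
          (\sum_(v < gorder G | (v < j)%N) \sum_(u | adj v u && o u v) cap u * w u) *+ 2].

Lemma fill_init U : fill_inv U 0 (fun u => if u \in U then 0 else w u).
Proof.
have mw : mask (fun u => if u \in U then 0 else w u).
  by move=> u; case: ifP; [left|right].
split=> // [u -> //|k t _].
rewrite -mask_sum // [\sum_(v < _ | _) _]big_pred0 // mul0rn addr0.
rewrite (eq_bigl (mem U)) // => u; rewrite inE /=.
by case: ifP => _; rewrite ?eqxx // gt_eqF.
Qed.

Definition reset ww b := fun u => if u == b then 0 else ww u.

(** If [b] is new, nothing in the closed neighbourhood of [v] has been chosen, so all of it is
    light. By [light_in_heavy] the in-neighbours of [v] have capacity at least [k / 2], and none is
    cheaper than [b]. *)
Lemma fill_step U ww (v : 'I_(gorder G)) b : fill_inv U v ww -> cadj v b ->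
    (forall u, cadj v u -> ww b <= ww u) -> fill_inv U v.+1 (reset ww b).
Proof.
move=> [mw Uw domw costw] vb minb; split.
- by move=> u; rewrite /reset; case: eqP => _; [left|].
- by move=> u /Uw u0; rewrite /reset u0; case: eqP.
- move=> x; rewrite ltnS leq_eqVlt => /orP[/eqP/val_inj ->|/domw[u xu u0]].
    by exists b => //; rewrite /reset eqxx.
  by exists u => //; rewrite /reset u0; case: eqP.
move=> k t th; have [mink t0 kt UE] := th; have := costw _ _ th.
have -> : \sum_u (w u - reset ww b u) = \sum_u (w u - ww u) + ww b.
  rewrite (bigD1 b) //= [in RHS](bigD1 b) //= /reset eqxx.
  rewrite (eq_bigr (fun u => w u - ww u)); last by move=> u /negbTE ->.
  by ring.
rewrite sum_ltS.
suff : k * ww b <= (\sum_(u | adj v u && o u v) cap u * w u) *+ 2.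
  by rewrite mulrDr mulrnDl; lra.
have [->|wb] := mw b; first by rewrite mulr0 mulrn_wge0 ?sumr_ge0 // => u _;
  rewrite mulr_ge0 // ltW.
have light u : cadj v u -> cap u <= t.
  move=> vu; rewrite leNgt -UE; apply/negP => /Uw u0.
  by have := minb _ vu; rewrite u0 wb leNgt w_gt0.
have wle u : adj v u -> w b <= w u.
  move=> vu; have := minb u; rewrite /cadj vu orbT => /(_ isT).
  have [->|->] := mw u; last by rewrite wb.
  by rewrite wb leNgt w_gt0.
have heavy : k <= (\sum_(u | adj v u && o u v) cap u) *+ 2.
  apply: (light_in_heavy cap_ge0 o_total o_out mink t0 kt).
    by apply: light; rewrite /cadj eqxx.
  by move=> u vu; apply: light; rewrite /cadj vu orbT.
apply: (@le_trans _ _ ((\sum_(u | adj v u && o u v) cap u) *+ 2 * ww b)).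
  by rewrite ler_wpM2r // wb ltW.
rewrite mulrnAl lerMn2r /= big_distrl /= ler_sum // => u /andP[vu _].
by rewrite wb ler_wpM2l // wle.
Qed.

Definition total_cost : R := \sum_u cap u * w u.

(** A heavy vertex has capacity above [t], which gives the factor [2 * d.+1]; every vertex is an
    in-neighbour of at most [d] others, and the charge to entering edges is doubled, which gives
    [2 * d] more. *)
Lemma fill_cost U ww k t : fill_inv U (gorder G) ww -> threshold k t U ->
  k * (\sum_(u in zeros ww) w u) <= (4 * d + 2)%:R * total_cost.
Proof.
move=> [mw _ _ cost] th; rewrite mask_sum //; apply: le_trans (cost _ _ th) _.
have [_ t0 kt UE] := th.
have cw0 u : 0 <= cap u * w u by rewrite mulr_ge0 // ltW.
have costU : k * (\sum_(u in U) w u) <= (2 * d.+1)%:R * total_cost.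
  rewrite !big_distrr /= big_mkcond ler_sum // => u _.
  case: ifP => [|_]; last by rewrite mulr_ge0.
  rewrite UE => /ltW tu; rewrite kt -mulrnAr natrM [2 * _]mulrC -!mulrA ler_wpM2l //.
  by have := ler_wpM2r (ltW (w_gt0 u)) tu; rewrite mulr2n mulrDl; lra.
have cost_in : \sum_(v < gorder G | (v < gorder G)%N)
    \sum_(u | adj v u && o u v) cap u * w u <= d%:R * total_cost.
  rewrite (exchange_big_dep predT) //= big_distrr /= ler_sum // => u _.
  rewrite sumr_const -[leLHS]mulr_natl ler_wpM2r // ler_nat.
  apply: leq_trans (o_out u); apply: subset_leq_card; apply/subsetP => v.
  by case/and3P => _ _ ouv; rewrite inE.
have -> : (4 * d + 2)%:R * total_cost =
    (2 * d.+1)%:R * total_cost + (d%:R * total_cost) *+ 2.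
  by rewrite natrD !natrM -[d.+1%:R]natr1; ring.
by rewrite lerD // lerMn2r.
Qed.

(** * Joining the classes of a dominating set in the order of Kruskal *)

Definition classes (lab : vertex G -> vertex G) := #|lab @: [set: vertex G]|.

Definition dominator ww (f : vertex G -> vertex G) :=
  [/\ forall v, cadj v (f v), forall v, ww (f v) = 0 &
      forall v, ww v = 0 -> f v = v].

Lemma mem_classes (lab : vertex G -> vertex G) x : lab x \in lab @: [set: vertex G].
Proof. by apply: imset_f; rewrite inE. Qed.

Definition merge (lab : vertex G -> vertex G) u v :=
  fun x => if lab x == lab v then lab u else lab x.

(** [sigma] is the cost of the latest merge, 0 at the start. While this level rises, [k] times the
    number of classes is paid by the vertices with [w x *+ 2] above the level;
    [Num.min (w x *+ 2) sigma] is the amount of rise that [x] has paid for. The term with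
    [classes lab] is credit for later merges. *)
Definition conn_inv ww f U j lab D :=
  [/\ zeros ww \subset D,
      forall x y, lab x = lab y -> connect (induced_adj D) (f x) (f y),
      forall x, lab (f x) = lab x,
      (classes lab + j <= gorder G)%N \/ forall x y, lab x = lab y
    & exists sigma, [/\ 0 <= sigma,
        forall u v, adj u v -> lab u != lab v -> sigma <= ww u + ww v
      & forall k t, threshold k t U ->
          k * (\sum_(x in D) w x) + k * (classes lab)%:R * sigma <=
          k * (\sum_(x in zeros ww) w x) +
          (d%:R * \sum_x cap x * Num.min (w x *+ 2) sigma) *+ 2]].

Lemma conn_init ww f U : mask ww -> dominator ww f -> conn_inv ww f U 0 f (zeros ww).
Proof.
move=> mw [_ f0 fE]; split=> //.
- by move=> x y ->.
- by move=> x; rewrite fE.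
- by left; rewrite addn0; apply: leq_trans (max_card _) _; rewrite card_ord.
have ww0 x : 0 <= ww x by case: (mw x) => ->; rewrite // ltW.
exists 0; split=> // [u v _ _|k t _]; first exact: addr_ge0.
rewrite mulr0 addr0 lerDl mulrn_wge0 // mulr_ge0 // sumr_ge0 // => x _.
by rewrite mulr_ge0 // le_min lexx mulrn_wge0 // ltW.
Qed.

Lemma conn_stop ww f U j lab D : conn_inv ww f U j lab D ->
    connected_graph G -> (forall u v, adj u v -> lab u = lab v) ->
  conn_inv ww f U j.+1 lab D.
Proof.
move=> [? ? ? _ ?] /connected_setP[_ conn] same; split=> //; right=> x y.
have clx : closed (induced_adj [set: vertex G]) [pred z | lab z == lab x].
  by move=> u v /and3P[_ _ uv]; rewrite !inE (same _ _ uv).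
have := closed_connect clx (conn x y (in_setT _) (in_setT _)).
by rewrite !inE eqxx => /esym/eqP.
Qed.

Section ConnStep.
Variable r : nat.
Hypotheses (noK : excludes_clique G r) (d_def : d = (2 ^ r.+1)%N).
Variables (ww : vertex G -> R) (f lab : vertex G -> vertex G).
Variables (U D : {set vertex G}).
Hypotheses (mw : mask ww) (domf : dominator ww f).
Hypothesis Uww : {in U, forall u, ww u = 0}.
Hypothesis labf : forall x, lab (f x) = lab x.

(* Every component of H = zeros ww :|: [set x | 2 w x < s] is contained in one
   class and has a boundary of capacity at least k outside H. *)
Lemma classes_bound s k t : 0 < s -> threshold k t U -> (1 < classes lab)%N ->
    (forall u v, adj u v -> lab u != lab v -> s <= ww u + ww v) ->
  k * (classes lab)%:R <= (d%:R * \sum_(x | s <= w x *+ 2) cap x) *+ 2.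
Proof.
move=> s0 [mink t0 kt UE] cl1 min_s; have [_ f0 fE] := domf.
pose H := zeros ww :|: [set x | w x *+ 2 < s].
have repP l : l \in lab @: [set: vertex G] -> {x | lab x == l}.
  by move=> /imsetP lP; apply: sigW; have [x _ ->] := lP; exists x.
(* A chosen vertex with label [l]; the default is not reached for labels in use. *)
pose rep l := if [pick x | lab x == l] is Some x then f x else l.
have labrep l : l \in lab @: [set: vertex G] -> lab (rep l) = l /\ ww (rep l) = 0.
  move=> /repP[x lx]; rewrite /rep; case: pickP => [y /eqP <-|/(_ x)].
    by rewrite labf f0.
  by rewrite lx.
pose S := rep @: (lab @: [set: vertex G]).
have cardS : #|S| = classes lab.
  apply: card_in_imset => l l' /labrep[ll _] /labrep[ll' _] eq_rep.
  by rewrite -ll eq_rep ll'.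
have SH : S \subset H.
  by apply/subsetP => x /imsetP[l /labrep[_ l0] ->]; rewrite !inE l0 eqxx.
have lightH x : x \in H -> ww x *+ 2 < s.
  rewrite !inE => /orP[/eqP->|]; first by rewrite mul0rn.
  by have [->|->] := mw x; rewrite // mul0rn.
(* An edge inside [H] costs less than [s], so it cannot join two classes. *)
have cl l : closed (induced_adj H) [pred z | lab z == l].
  move=> x y /and3P[/lightH xs /lightH ys xy]; rewrite !inE.
  suff -> : lab x = lab y by [].
  apply/eqP/negPn/negP => /(min_s _ _ xy); apply/negP.
  by rewrite -ltNge; move: xs ys; rewrite !mulr2n; lra.
have sepS : {in S &, forall x y, connect (induced_adj H) x y -> x = y}.
  move=> _ _ /imsetP[l lP ->] /imsetP[l' l'P ->] /(closed_connect (cl l)).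
  rewrite !inE; have [-> _] := labrep _ lP; have [-> _] := labrep _ l'P.
  by rewrite eqxx => /esym/eqP ->.
have outH x : x \notin H -> cap x <= t.
  rewrite !inE negb_or => /andP[wx _]; rewrite leNgt -UE; apply: contra wx.
  by move=> /Uww ->.
rewrite d_def in kt *; rewrite -cardS in cl1 *.
apply: le_trans (separated_count cap_ge0 noK mink t0 kt outH SH cl1 sepS) _.
rewrite lerMn2r /= ler_wpM2l // big_mkcond [leRHS]big_mkcond ler_sum // => x _.
rewrite !inE negb_or -leNgt; case: ifP => [/andP[_ ->] //|_].
by case: ifP.
Qed.

(** The level rises to the cost [s] of the new pair; the disappearance of one class then frees
    [k * s], which covers the at most two vertices added. *)
Lemma conn_step j u v : conn_inv ww f U j lab D -> adj u v -> lab u != lab v ->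
    (forall x y, adj x y -> lab x != lab y -> ww u + ww v <= ww x + ww y) ->
  conn_inv ww f U j.+1 (merge lab u v) (u |: (v |: D)).
Proof.
move=> [zD cD _ cl [sigma [s0 min_sg cost]]] uv luv min_s.
have [fadj f0 fE] := domf.
have sD : D \subset u |: (v |: D) by apply/subsetP => x xD; rewrite !inE xD !orbT.
have fD x : f x \in D by rewrite (subsetP zD) // inE f0.
have fD' x : f x \in u |: (v |: D) by rewrite (subsetP sD).
have to_f x : x \in u |: (v |: D) -> connect (induced_adj (u |: (v |: D))) x (f x).
  move=> xD; have /orP[/eqP->|xf] := fadj x; first exact: connect0.
  by apply: connect1; apply/and3P.
have uD : u \in u |: (v |: D) by rewrite !inE eqxx.
have vD : v \in u |: (v |: D) by rewrite !inE eqxx orbT.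
(* The walk [f u], [u], [v], [f v] stays in the enlarged set and joins the two classes. *)
have fuv : connect (induced_adj (u |: (v |: D))) (f u) (f v).
  apply: connect_trans (to_f _ vD).
  apply: (@connect_trans _ _ u); first by rewrite induced_sym to_f.
  by apply: connect1; apply/and3P.
have keep x y : lab x = lab y -> connect (induced_adj (u |: (v |: D))) (f x) (f y).
  by move=> /cD; apply: connect_induced_sub.
have drop : ((classes (merge lab u v)).+1 <= classes lab)%N.
  rewrite /classes (cardsD1 (lab v) (lab @: _)) mem_classes ltnS.
  apply: subset_leq_card; apply/subsetP => _ /imsetP[x _ ->].
  rewrite in_setD1 /merge; have [_|ne] := eqVneq (lab x) (lab v).
    by rewrite luv mem_classes.
  by rewrite ne mem_classes.
have cl1 : (1 < classes lab)%N.
  apply: leq_trans drop; rewrite ltnS card_gt0; apply/set0Pn.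
  by exists (merge lab u v u); apply: mem_classes.
split.
- exact: subset_trans sD.
- move=> x y; rewrite /merge; case: eqP => [xv|_]; case: eqP => [yv|_] //.
  + by move=> _; apply: keep; rewrite xv yv.
  + by move=> uy; apply: connect_trans (keep _ _ xv) _;
      rewrite induced_sym; apply: connect_trans fuv; rewrite induced_sym keep.
  + by move=> xu; apply: connect_trans (keep _ _ xu) _;
      apply: connect_trans fuv _; rewrite keep.
  + exact: keep.
- by move=> x; rewrite /merge !labf.
- left; case: cl => [le|same]; last by rewrite (same u v) eqxx in luv.
  by rewrite addnS -addSn; apply: leq_trans le; rewrite leq_add2r.
pose s := ww u + ww v; have sgs : sigma <= s by apply: min_sg.
exists s; split; first exact: le_trans sgs.
  move=> x y xy; rewrite /merge => nexy; apply: min_s => //.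
  by apply: contraNneq nexy => ->.
move=> k t th; have := cost k t th; have [mink t0 kt UE] := th.
have k0 : 0 <= k.
  by rewrite kt mulrn_wge0 // mulr_ge0.
have wD : \sum_(x in u |: (v |: D)) w x <= \sum_(x in D) w x + s.
  have add x (A : {set vertex G}) : D \subset A ->
      \sum_(y in x |: A) w y <= \sum_(y in A) w y + ww x.
    move=> DA; have [xA|xA] := boolP (x \in A).
      rewrite (setUidPr _) ?sub1set // lerDl.
      by case: (mw x) => ->; rewrite // ltW.
    rewrite big_setU1 //= addrC lerD2l; case: (mw x) => [x0|->] //.
    by case/negP: xA; rewrite (subsetP DA) // (subsetP zD) // inE x0.
  apply: le_trans (add u _ _) _; first exact: subsetUr.
  by have := add v D (subxx _); rewrite /s; lra.
have cl' : (classes (merge lab u v))%:R + 1 <= (classes lab)%:R :> R.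
  by rewrite natr1 ler_nat.
(* By [classes_bound] the rise is paid by the vertices with [s <= w x *+ 2], and for these the
   minimum grows by exactly [s - sigma]. *)
have main : k * (classes lab)%:R * (s - sigma) <=
    (d%:R * (\sum_x cap x * Num.min (w x *+ 2) s -
             \sum_x cap x * Num.min (w x *+ 2) sigma)) *+ 2.
  have [s_le|s_gt] := leP s 0.
    have -> : s = sigma by apply/eqP; rewrite eq_le sgs (le_trans s_le).
    by rewrite !subrr !mulr0 mul0rn.
  have := classes_bound s_gt th cl1 min_s.
  move=> /(ler_wpM2r (x := s - sigma)); rewrite subr_ge0 => /(_ sgs) /le_trans.
  apply; rewrite [_ *+ 2 * _]mulrnAl lerMn2r /= -mulrA ler_wpM2l // big_distrl /= -sumrB.
  rewrite big_mkcond ler_sum // => x _; rewrite -mulrBr.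
  case: ifP => [sw|_]; last first.
    rewrite mulr_ge0 // subr_ge0 le_min ge_min lexx /=.
    by rewrite ge_min sgs orbT.
  by rewrite ler_wpM2l // (min_r sw) (min_r (le_trans sgs sw)).
have ks : 0 <= k * s by rewrite mulr_ge0 // (le_trans s0).
have := ler_wpM2l k0 wD; have := ler_wpM2l ks cl'.
move: main; rewrite !mulr2n.
move: (\sum_(x in u |: _) _) (\sum_(x in D) _) (\sum_(x in zeros ww) _).
move: (\sum_x cap x * Num.min _ s) (\sum_x cap x * Num.min _ sigma).
by move: (_%:R) (_%:R) => q' q a b x y z; lra.
Qed.

End ConnStep.

Lemma conn_final ww f U lab D : connected_graph G -> mask ww -> dominator ww f ->
    conn_inv ww f U (gorder G) lab D ->
  connected_dominating D /\
  forall k t, threshold k t U -> k * (\sum_(x in D) w x) <=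
     k * (\sum_(x in zeros ww) w x) + (4 * d)%:R * total_cost.
Proof.
move=> /connected_setP[[x0 _] _] mw [fadj f0 fE] [zD cD _ cl [s [s0 _ cost]]].
have fD x : f x \in D by rewrite (subsetP zD) // inE f0.
have to_f x : x \in D -> connect (induced_adj D) x (f x).
  move=> xD; have /orP[/eqP->|xf] := fadj x; first exact: connect0.
  by apply: connect1; apply/and3P.
split.
  apply/andP; split.
    apply/forallP => x; apply/implyP => xD; apply/existsP; exists (f x).
    rewrite fD /=; have /orP[/eqP fx|//] := fadj x.
    by rewrite -fx fD in xD.
  apply/connected_setP; split=> [|x y xD yD]; first by exists (f x0).
  apply: connect_trans (to_f _ xD) _; rewrite induced_sym.
  apply: connect_trans (to_f _ yD) _; rewrite induced_sym; apply: cD.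
  (* After [gorder G] rounds the counting alternative would leave no label at all. *)
  case: cl => //; rewrite -[leqRHS]add0n leq_add2r leqn0 cards_eq0 => /eqP no_lab.
  by have := mem_classes lab x0; rewrite no_lab inE.
move=> k t th; have := cost k t th; have [_ t0 kt _] := th.
have k0 : 0 <= k by rewrite kt mulrn_wge0 // mulr_ge0.
have : 0 <= k * (classes lab)%:R * s by rewrite !mulr_ge0.
have : d%:R * (\sum_x cap x * Num.min (w x *+ 2) s) <= d%:R * (total_cost *+ 2).
  rewrite ler_wpM2l // -sumrMnl ler_sum // => x _.
  by rewrite -mulrnAr ler_wpM2l // ge_min lexx.
rewrite natrM !mulr2n; move: (\sum_x cap x * _) (\sum_(x in D) _) (\sum_(x in zeros _) _).
move=> a b e ? ? ?; lra.
Qed.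

(** Domination contributes [4 * d + 2] and connection [4 * d]. *)
Lemma threshold_weight_bound ww f U lab D k t : connected_graph G ->
    fill_inv U (gorder G) ww -> dominator ww f ->
    conn_inv ww f U (gorder G) lab D -> threshold k t U ->
  k * (\sum_(x in D) w x) <= (8 * d + 2)%:R * total_cost.
Proof.
move=> cG fi df ci th; have [mw _ _ _] := fi.
have [_ /(_ _ _ th) le1] := conn_final cG mw df ci.
apply: le_trans le1 _; have := fill_cost fi th.
by rewrite ![(_ * d + 2)%:R]natrD ![(_ * d)%:R]natrM; lra.
Qed.

End Oracle.

(** * Multiplicative weights *)

Section Packing.
Variables (R : realType) (G : sgraph) (cap : vertex G -> R) (C : R).
Hypotheses (cap_ge0 : forall v, 0 <= cap v) (C_ge0 : 0 <= C).
Implicit Types (u v : vertex G) (p a w : vertex G -> R) (D : {set vertex G}).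
Implicit Types L : seq ({set vertex G} * R).

(** Take for [c] the largest capacity not above [t], or 0 if all capacities exceed [t]. So finitely
    many candidates, read off the input, replace the unknown [t]. *)
Lemma exists_threshold d k : min_separator_capacity cap k -> 0 < k ->
  exists t c, (c = 0 \/ exists v, c = cap v) /\
    threshold cap d k t [set u | c < cap u].
Proof.
move=> mink k0; pose t := k / (d.+1%:R *+ 2).
have t0 : 0 < t by rewrite divr_gt0 // mulrn_wgt0.
have kt : k = d.+1%:R * t *+ 2.
  by rewrite -mulrnAl mulrC divfK // mulrn_eq0 /= pnatr_eq0.
have [/existsP[v0 v0t]|all_gt] := boolP [exists v, cap v <= t].
  have [v vt vmax] := @arg_maxP _ _ _ v0 (fun v => cap v <= t) cap v0t.
  exists t, (cap v); split; first by right; exists v.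
  split=> // [|u]; first exact: ltW.
  rewrite inE; apply/idP/idP => [vu|]; last exact: le_lt_trans.
  by rewrite ltNge; apply: contraL vu => /vmax; rewrite -leNgt.
exists t, 0; split; first by left.
split=> // [|u]; first exact: ltW.
have tu : t < cap u.
  by rewrite ltNge; move: all_gt; rewrite negb_exists => /forallP.
by rewrite inE tu (lt_trans t0).
Qed.

Definition oracle_set w D := connected_dominating D /\
  forall k, min_separator_capacity cap k -> 0 < k ->
    k * (\sum_(v in D) w v) <= C * total_cost cap w.

(** Vertices of capacity 0 get a price prohibitive for every [k > 0]: a minimum separator contains
    some [u] with [0 < cap u <= k], so [k] times the second factor is at least 1 and [k] times the
    price exceeds [C * \sum_u p u]. The inverse of 0 is 0, so the sum of inverses ignores these
    vertices. *)
Definition prices p v := if cap v <= 0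
  then (C * (\sum_u p u) + 1) * (\sum_u (cap u)^-1 + 1) else p v / cap v.

Lemma inv_cap_ge0 : 0 <= \sum_u (cap u)^-1.
Proof. by apply: sumr_ge0 => u _; rewrite invr_ge0. Qed.

Lemma prices_gt0 p v : (forall u, 0 < p u) -> 0 < prices p v.
Proof.
move=> p0; rewrite /prices; case: (leP (cap v) 0) => [_|cv]; last by rewrite divr_gt0.
have P0 : 0 <= \sum_u p u by apply: sumr_ge0 => u _; apply: ltW.
by rewrite mulr_gt0 // ltr_wpDl ?mulr_ge0 ?inv_cap_ge0.
Qed.

Lemma total_cost_prices p : (forall u, 0 < p u) ->
  total_cost cap (prices p) <= \sum_u p u.
Proof.
move=> p0; apply: ler_sum => u _; rewrite /prices; case: (leP (cap u) 0) => [cu|cu].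
  suff -> : cap u = 0 by rewrite mul0r ltW.
  by apply/eqP; rewrite eq_le cu cap_ge0.
by rewrite mulrC divfK // gt_eqF.
Qed.

(* This is what the price of the vertices of capacity 0 is chosen for. *)
Lemma oracle_avoids_zero p D k v : (forall u, 0 < p u) ->
    oracle_set (prices p) D -> min_separator_capacity cap k -> 0 < k ->
  v \in D -> 0 < cap v.
Proof.
move=> p0 [_ costD] mink k0 vD; rewrite ltNge; apply/negP => cv.
have [[S [_ capS]] _] := mink.
have [u uS cu] : exists2 u, u \in S & 0 < cap u.
  apply/exists_inP; apply: contraLR k0 => none; rewrite -leNgt -capS.
  apply: sumr_le0 => u uS; rewrite leNgt.
  by move: none; rewrite negb_exists_in => /forall_inP; apply.
have uk : cap u <= k.
  rewrite -capS /capacity (big_setD1 u) //= lerDl.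
  exact: sumr_ge0.
have kQ : 1 <= k * (\sum_u (cap u)^-1 + 1).
  apply: (@le_trans _ _ (cap u * (cap u)^-1)); first by rewrite mulfV ?gt_eqF.
  apply: ler_pM => //; first by rewrite invr_ge0.
  rewrite (bigD1 u) //= -addrA lerDl addr_ge0 //.
  by apply: sumr_ge0 => x _; rewrite invr_ge0.
have P0 : 0 <= \sum_u p u by apply: sumr_ge0 => x _; apply: ltW.
have := costD _ mink k0; apply/negP; rewrite -ltNge.
apply: (@le_lt_trans _ _ (C * \sum_u p u)); first by rewrite ler_wpM2l ?total_cost_prices.
apply: (@lt_le_trans _ _ (k * prices p v)); last first.
  rewrite ler_wpM2l ?(ltW k0) // (big_setD1 v) //= lerDl.
  by apply: sumr_ge0 => x _; rewrite ltW ?prices_gt0.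
rewrite /prices cv mulrCA; apply: (@lt_le_trans _ _ (C * \sum_u p u + 1)).
  by rewrite ltrDl.
by rewrite ler_peMr // addr_ge0 ?mulr_ge0.
Qed.

(** [a v] is the load of [v] relative to its capacity and [p v] its potential. The bound on [size L]
    records that every round raises the total relative load by at least 1. *)
Definition packing_inv p a L :=
  [/\ forall v, 0 <= a v,
      forall v, expR (a v / 2) <= p v,
      {in L, forall Da, connected_dominating Da.1 /\ 0 <= Da.2},
      forall v, \sum_(Da <- L | v \in Da.1) Da.2 = a v * cap v
    & forall k, min_separator_capacity cap k -> 0 < k ->
        \sum_v p v <= (gorder G)%:R * expR (C * packing_size L / k) /\
        (size L)%:R <= \sum_v a v].

Lemma packing_init : packing_inv (fun=> 1) (fun=> 0) [::].
Proof.
split=> // [v|v|k _ _]; first by rewrite mul0r expR0.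
  by rewrite big_nil mul0r.
rewrite /packing_size big_nil mulr0 mul0r expR0 mulr1 !sumr_const card_ord.
by rewrite mul0rn.
Qed.

(** From [1 - x / 2 <= expR (- (x / 2))] and [1 <= (1 - x / 2) * (1 + x)] on the unit interval. *)
Lemma expR_half_le x : 0 <= x <= 1 -> expR (x / 2) <= 1 + x :> R.
Proof.
move=> /andP[x0 x1].
have h := expR_ge1Dx (- (x / 2)).
have h0 : 0 < 1 - x / 2 by lra.
rewrite -[x / 2]opprK expRN -[1 + x]invrK lef_pV2 ?posrE ?expR_gt0 ?invr_gt0 //; last by lra.
apply: le_trans h; rewrite -[leLHS]mul1r ler_pdivrMr; last by lra.
nra.
Qed.

(** The potentials grow in total by [alpha] times the price of [D], at most the fraction
    [C * alpha / k] of their sum, and [1 + x <= expR x]. The vertex of [D] with the least capacity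
    gains relative load exactly 1. *)
Lemma packing_step p a L D alpha : packing_inv p a L ->
    oracle_set (prices p) D -> {in D, forall v, alpha <= cap v} ->
    (exists2 v, v \in D & alpha = cap v) ->
  packing_inv (fun v => if v \in D then p v * (1 + alpha / cap v) else p v)
    (fun v => if v \in D then a v + alpha / cap v else a v)
    (rcons L (D, alpha)).
Proof.
move=> [a0 ap okL sumL bound] orD le_cap [v0 v0D alphaE].
have al0 : 0 <= alpha by rewrite alphaE.
have p0 v : 0 < p v by apply: lt_le_trans (ap v); apply: expR_gt0.
have ratio v : v \in D -> 0 <= alpha / cap v <= 1.
  move=> vD; rewrite divr_ge0 //=.
  have [->|cv] := eqVneq (cap v) 0; first by rewrite invr0 mulr0.
  by rewrite ler_pdivrMr ?lt_def ?cv ?cap_ge0 // mul1r le_cap.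
split.
- move=> v; case: ifP => // /ratio /andP[? _]; exact: addr_ge0.
- move=> v; case: ifP => // /ratio vr.
  by rewrite mulrDl expRD ler_pM ?expR_ge0 ?expR_half_le.
- by move=> Da; rewrite mem_rcons inE => /orP[/eqP-> /=|/okL//]; case: orD.
- move=> v; rewrite -cats1 big_cat /= big_cons big_nil /= sumL.
  case: ifP => vD; rewrite addr0 //.
  rewrite mulrDl; congr (_ + _).
  have [cv|cv] := eqVneq (cap v) 0; last by rewrite divfK.
  by rewrite cv mulr0; apply/eqP; rewrite eq_le al0 andbT -cv le_cap.
move=> k mink k0; have [boundP boundA] := bound _ mink k0.
have capD v : v \in D -> 0 < cap v by apply: oracle_avoids_zero mink k0.
split.
  have -> : \sum_v (if v \in D then p v * (1 + alpha / cap v) else p v) =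
            \sum_v p v + alpha * \sum_(v in D) prices p v.
    rewrite big_distrr /= [X in _ + X]big_mkcond -big_split /=.
    apply: eq_bigr => v _; case: ifP => [vD|_]; last by rewrite addr0.
    by rewrite /prices leNgt capD //=; ring.
  rewrite /packing_size -cats1 big_cat big_seq1 /= -/(packing_size L).
  have P0 : 0 <= \sum_u p u by apply: sumr_ge0 => x _; apply: ltW.
  have [_ /(_ _ mink k0) costD] := orD.
  have costD' : \sum_(v in D) prices p v <= C * (\sum_u p u) / k.
    rewrite ler_pdivlMr // mulrC; apply: le_trans costD _.
    by rewrite ler_wpM2l ?total_cost_prices.
  have -> : C * (packing_size L + alpha) / k = C * packing_size L / k + C * alpha / k.
    by rewrite mulrDr mulrDl.
  rewrite expRD mulrA.
  apply: (@le_trans _ _ ((\sum_v p v) * (1 + C * alpha / k))).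
    rewrite mulrDr mulr1 lerD2l.
    apply: le_trans (ler_wpM2l al0 costD') _.
    by rewrite le_eqVlt; apply/orP; left; apply/eqP; ring.
  apply: ler_pM => //; last exact: expR_ge1Dx.
  by rewrite addr_ge0 // divr_ge0 ?mulr_ge0 // ltW.
rewrite size_rcons -natr1.
apply: (@le_trans _ _ (\sum_v (a v + (v == v0)%:R))).
  rewrite big_split /= lerD //.
  by rewrite (bigD1 v0) //= eqxx big1 ?addr0 // => v /negbTE ->.
apply: ler_sum => v _; case: eqP => [->|_].
  by rewrite v0D alphaE mulfV // gt_eqF // capD.
by rewrite addr0; case: ifP => // /ratio /andP[? _]; rewrite lerDl.
Qed.

Definition scale (M : R) L := [seq (Da.1, Da.2 / M) | Da <- L].

(** The number of rounds forces [M] to be at least four times the order [n]. Comparing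
    [expR (M / 2)] with the sum of potentials gives [M / 2 <= n + C * packing_size L / k], and
    [n <= M / 4] is absorbed. *)
Lemma packing_final p a L M : packing_inv p a L -> connected_graph G ->
    size L = (4 * gorder G * gorder G)%N ->
    (forall v, a v <= M) -> (exists v, a v = M) ->
  fractional_cd_packing cap (scale M L) /\
  forall k, min_separator_capacity cap k ->
    (4 * C)^-1 * k <= packing_size (scale M L).
Proof.
move=> [a0 ap okL sumL bound] cG sizeL aM [v0 av0].
have M0 : 0 <= M by rewrite -av0.
have sizeE : packing_size (scale M L) = packing_size L / M.
  by rewrite /packing_size big_map big_distrl.
have A0 : 0 <= packing_size L.
  by rewrite /packing_size big_seq sumr_ge0 // => Da /okL[].
split.
  split=> [Da|Da|v].
  - by case/mapP=> Da' /okL[cd _] ->.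
  - by case/mapP=> Da' /okL[_ ge] ->; rewrite divr_ge0.
  rewrite big_map /= -big_distrl /= sumL mulrAC -[leRHS]mul1r ler_wpM2r //.
  (* Division by 0 gives 0, so [M = 0] merely makes the weights vanish. *)
  have [->|M_nz] := eqVneq M 0; first by rewrite invr0 mulr0.
  by rewrite ler_pdivrMr ?lt_def ?M_nz // mul1r.
move=> k mink; rewrite sizeE; have [k_le|k0] := leP k 0.
  apply: (@le_trans _ _ 0); last exact: divr_ge0.
  by rewrite mulr_ge0_le0 // invr_ge0 mulr_ge0.
have [boundP boundA] := bound _ mink k0.
have n0 : (0 < gorder G)%N by case: (v0) => m; apply: leq_ltn_trans.
have nM : (4 * gorder G)%:R <= M.
  have : (size L)%:R <= (gorder G)%:R * M.
    apply: le_trans boundA _; apply: (@le_trans _ _ (\sum_(v : vertex G) M)).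
      exact: ler_sum.
    by rewrite sumr_const card_ord mulr_natl.
  by rewrite sizeL natrM mulrC ler_pM2l // ltr0n.
have Mpos : 0 < M by apply: lt_le_trans nM; rewrite ltr0n muln_gt0.
have key : M / 2 <= (gorder G)%:R + C * packing_size L / k.
  rewrite -ler_expR expRD -{1}av0; apply: le_trans (ap v0) _.
  apply: (@le_trans _ _ (\sum_v p v)).
    rewrite (bigD1 v0) //= lerDl sumr_ge0 // => v _.
    exact: le_trans (expR_ge0 _) (ap v).
  apply: le_trans boundP _; rewrite ler_wpM2r ?expR_ge0 //.
  by apply: le_trans (expR_ge1Dx _); rewrite lerDr.
have : M / 4 <= C * packing_size L / k.
  by move: nM; rewrite natrM; lra.
rewrite ler_pdivlMr // ler_pdivlMr // => MkC.
have [->|C_nz] := eqVneq C 0; first by rewrite mulr0 invr0 !mul0r.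
have Cpos : 0 < C by rewrite lt_def C_nz.
rewrite -mulrA ler_pdivrMl ?mulr_gt0 //; move: MkC; lra.
Qed.

End Packing.

(** * Bounded programs *)

(* Programs all of whose loops are bounded by a linear function of the number of
   vertices.  They have a total semantics [run] and an a priori cost. *)
Inductive prog :=
| PNSet of nat & nexp & nexp & nexp
| PRSet of nat & nexp & nexp & rexp
| PSeq of prog & prog
| PIf of bexp & prog
| PFor of nat & nat & nat & prog.  (* PFor c k l P: for c[0, 0] < k n + l do P *)

Definition nvar a := NGet a (NConst 0) (NConst 0).

(** Integer expressions have no product, so the multiple of the order is an iterated sum. *)
Definition linear_nexp k l := iter k (NAdd (nvar 0)) (NConst l).

Fixpoint compile (P : prog) : cmd :=
  match P with
  | PNSet a i j e => NSet a i j e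
  | PRSet a i j e => RSet a i j e
  | PSeq P1 P2 => Seq (compile P1) (compile P2)
  | PIf b P1 => If b (compile P1) Skip
  | PFor c k l P1 =>
      Seq (NSet c (NConst 0) (NConst 0) (NConst 0))
        (While (NLe (NAdd (nvar c) (NConst 1)) (linear_nexp k l))
           (Seq (compile P1)
              (NSet c (NConst 0) (NConst 0) (NAdd (nvar c) (NConst 1)))))
  end.

(** An upper bound as a polynomial in the order: an iteration adds its test and its increment, a
    loop its initialisation and last test. *)
Fixpoint cost (P : prog) : {poly nat} :=
  match P with
  | PNSet _ _ _ _ | PRSet _ _ _ _ => 1
  | PSeq P1 P2 => cost P1 + cost P2
  | PIf _ P1 => cost P1 + 2%:P
  | PFor _ k l P1 => (k%:P * 'X + l%:P) * (cost P1 + 2%:P) + 2%:P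
  end.

Fixpoint written_nat (P : prog) : seq nat :=
  match P with
  | PNSet a _ _ _ => [:: a]
  | PRSet _ _ _ _ => [::]
  | PSeq P1 P2 => written_nat P1 ++ written_nat P2
  | PIf _ P1 => written_nat P1
  | PFor c _ _ P1 => c :: written_nat P1
  end.

Fixpoint written_real (P : prog) : seq nat :=
  match P with
  | PNSet _ _ _ _ => [::]
  | PRSet a _ _ _ => [:: a]
  | PSeq P1 P2 => written_real P1 ++ written_real P2
  | PIf _ P1 => written_real P1
  | PFor _ _ _ P1 => written_real P1
  end.

Fixpoint counters_safe (P : prog) : bool :=
  match P with
  | PNSet _ _ _ _ | PRSet _ _ _ _ => true
  | PSeq P1 P2 => counters_safe P1 && counters_safe P2
  | PIf _ P1 => counters_safe P1
  | PFor c _ _ P1 => (c \notin written_nat P1) && counters_safe P1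
  end.

Section Run.
Variable R : realType.
Implicit Types s : state R.

Definition setn s a i j x := State (upd (nmem s) a i j x) (rmem s).
Definition setr s a i j x := State (nmem s) (upd (rmem s) a i j x).

Fixpoint run (P : prog) s : state R :=
  match P with
  | PNSet a i j e => setn s a (neval s i) (neval s j) (neval s e)
  | PRSet a i j e => setr s a (neval s i) (neval s j) (reval s e)
  | PSeq P1 P2 => run P2 (run P1 s)
  | PIf b P1 => if beval s b then run P1 s else s
  | PFor c k l P1 =>
      iteri (k * nmem s 0 0 0 + l) (fun j s' => setn (run P1 s') c 0 0 j.+1)
        (setn s c 0 0 0)
  end.

Definition frame (ns rs : seq nat) s s' :=
  (forall a, a \notin ns -> nmem s' a = nmem s a) /\
  (forall a, a \notin rs -> rmem s' a = rmem s a).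

Lemma frame_refl ns rs s : frame ns rs s s.
Proof. by split. Qed.

Lemma frame_trans ns rs s1 s2 s3 :
  frame ns rs s1 s2 -> frame ns rs s2 s3 -> frame ns rs s1 s3.
Proof. by move=> [n12 r12] [n23 r23]; split=> a aN; rewrite ?n23 ?r23 ?n12 ?r12. Qed.

Lemma frame_sub ns rs ns' rs' s s' : {subset ns <= ns'} -> {subset rs <= rs'} ->
  frame ns rs s s' -> frame ns' rs' s s'.
Proof.
move=> sn sr [fn fr].
by split=> a aN; [apply/fn/(contra _ aN)/sn|apply/fr/(contra _ aN)/sr].
Qed.

Lemma upd_other T (m : nat -> nat -> nat -> T) a i j x b :
  b != a -> upd m a i j x b = m b.
Proof. by move=> ba; apply/funext => i'; apply/funext => j'; rewrite /upd (negbTE ba). Qed.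

Lemma updE T (m : nat -> nat -> nat -> T) a i j x i' j' :
  upd m a i j x a i' j' = if (i' == i) && (j' == j) then x else m a i' j'.
Proof. by rewrite /upd eqxx. Qed.

Lemma frame_setn a i j x ns rs s : a \in ns -> frame ns rs s (setn s a i j x).
Proof.
by move=> aN; split=> b bN //=; rewrite upd_other //; apply: contraNneq bN => ->.
Qed.

Lemma frame_setr a i j x ns rs s : a \in rs -> frame ns rs s (setr s a i j x).
Proof.
by move=> aN; split=> b bN //=; rewrite upd_other //; apply: contraNneq bN => ->.
Qed.

Lemma run_frame P s : frame (written_nat P) (written_real P) s (run P s).
Proof.
elim: P s => /= [a i j e|a i j e|P1 IH1 P2 IH2|b P1 IH1|c k l P1 IH1] s.
- by apply: frame_setn; rewrite inE.
- by apply: frame_setr; rewrite inE.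
- apply: frame_trans (frame_sub _ _ (IH1 s)) (frame_sub _ _ (IH2 _)) => x;
    by rewrite mem_cat => ->; rewrite ?orbT.
- by case: ifP => _; [apply: IH1|apply: frame_refl].
elim: (_ + _)%N => [|m IHm] /=; first by apply: frame_setn; rewrite inE eqxx.
apply: frame_trans IHm _; apply: frame_trans (frame_setn _ _ _ _ _ _).
  by apply: frame_sub (IH1 _) => // x xn; rewrite inE xn orbT.
by rewrite inE eqxx.
Qed.

Lemma neval_linear k l s : neval s (linear_nexp k l) = (k * nmem s 0 0 0 + l)%N.
Proof. by elim: k => //= k ->; rewrite mulSn addnA. Qed.

(** The loop rule also supplies a frame, so that [I] need not mention the arrays that the body
    leaves alone. *)
Lemma run_for c k l P s (I : nat -> state R -> Prop) :
    I 0 (setn s c 0 0 0) ->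
    (forall j s', (j < k * nmem s 0 0 0 + l)%N -> nmem s' c 0 0 = j ->
       frame (c :: written_nat P) (written_real P) s s' ->
       I j s' -> I j.+1 (setn (run P s') c 0 0 j.+1)) ->
  I (k * nmem s 0 0 0 + l)%N (run (PFor c k l P) s).
Proof.
move=> I0 IS; rewrite /=; move: (_ + _)%N IS => N IS.
suff : forall m, (m <= N)%N ->
    let s' := iteri m (fun j s' => setn (run P s') c 0 0 j.+1) (setn s c 0 0 0) in
    [/\ nmem s' c 0 0 = m, frame (c :: written_nat P) (written_real P) s s'
      & I m s'] by move=> /(_ N (leqnn N)) [].
elim=> [_|m IHm mN] /=.
  by split=> //; [rewrite updE|apply: frame_setn; rewrite inE eqxx].
have [cm fm Im] := IHm (ltnW mN); split; first by rewrite updE.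
  apply: frame_trans fm _; apply: frame_trans (frame_setn _ _ _ _ _ _).
    by apply: frame_sub (run_frame _ _) => // x xn; rewrite inE xn orbT.
  by rewrite inE eqxx.
exact: IS.
Qed.

(** The compiled loop reevaluates its bound at each test, while [run] fixes it in advance; they
    agree because array 0 is never written and no body changes its own counter. *)
Lemma exec_run P s : counters_safe P -> 0%N \notin written_nat P ->
  exists2 t, exec (compile P) s t (run P s) & (t <= (cost P).[nmem s 0 0 0])%N.
Proof.
elim: P s => /= [a i j e|a i j e|P1 IH1 P2 IH2|b P1 IH1|c k l P1 IH1] s.
- by exists 1%N; [apply: exec_nset|rewrite hornerE].
- by exists 1%N; [apply: exec_rset|rewrite hornerE].
- rewrite mem_cat negb_or => /andP[c1 c2] /andP[n1 n2].
  have [t1 e1 le1] := IH1 s c1 n1; have [t2 e2 le2] := IH2 (run P1 s) c2 n2.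
  exists (t1 + t2)%N; first exact: exec_seq e1 e2.
  by rewrite hornerD leq_add // (leq_trans le2) // (run_frame P1 s).1.
- move=> c1 n1; have [t e1 le1] := IH1 s c1 n1.
  rewrite hornerD hornerC; case: ifP => bs.
    exists t.+1; last by rewrite -addn1 leq_add.
    by apply: exec_if; rewrite bs.
  exists 2%N; last exact: leq_addl.
  by apply: exec_if; rewrite bs; apply: exec_skip.
rewrite inE negb_or => /andP[cP1 c1] /andP[c0 n1].
set n := nmem s 0 0 0; set N := (k * n + l)%N.
pose f j s' := setn (run P1 s') c 0 0 j.+1.
pose K := (cost P1).[n].
have st m : nmem (iteri m f (setn s c 0 0 0)) 0 = nmem s 0 /\
            nmem (iteri m f (setn s c 0 0 0)) c 0 0 = m.
  elim: m => [|m [IHm _]] /=; first by rewrite updE upd_other.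
  by rewrite updE upd_other // (run_frame P1 _).1 // IHm.
set W := While _ _.
suff [t et let_] : exists2 t,
    exec W (setn s c 0 0 0) t (iteri N f (setn s c 0 0 0)) &
    (t <= N * (K + 2) + 1)%N.
  exists (1 + t)%N; last first.
    rewrite hornerD hornerM !hornerD hornerM !hornerC hornerX.
    rewrite -[leqRHS]/(N * (K + 2) + 2)%N; move: let_; lia.
  by apply: exec_seq et; apply: exec_nset.
(* Induction on the number of iterations still to be made. *)
suff : forall m, (m <= N)%N -> exists2 t,
    exec W (iteri (N - m) f (setn s c 0 0 0)) t (iteri N f (setn s c 0 0 0)) &
    (t <= m * (K + 2) + 1)%N.
  by move=> /(_ N (leqnn N)); rewrite subnn.
elim=> [_|m IHm mN].
  exists 1%N => //; rewrite subn0; apply: exec_while_false.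
  have [s0 sc] := st N.
  by rewrite /= sc neval_linear s0 -/n -/N addn1 ltnn.
have [t et let_] := IHm (ltnW mN).
set s1 := iteri (N - m.+1) f _; have [s0 sc] := st (N - m.+1)%N.
have [t1 e1 le1] := IH1 s1 c1 n1.
exists (t1 + 1 + t).+1; last by move: le1 let_; rewrite s0 -/n -/K; lia.
apply: exec_while_true (exec_seq e1 (exec_nset _ _ _ _ _)) _.
  by rewrite /= sc neval_linear s0 -/n -/N addn1; lia.
set s2 := State _ _; suff -> : s2 = iteri (N - m) f (setn s c 0 0 0) by [].
have -> : (N - m = (N - m.+1).+1)%N by lia.
by rewrite /s2 /= -/s1 (run_frame P1 s1).1 // sc addn1.
Qed.

End Run.

(** * The oracle *)

Definition narr a i := NGet a i (NConst 0).
Definition rvar a := RGet a (NConst 0) (NConst 0).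
Definition rarr a i := RGet a i (NConst 0).
Definition let_nat a e := PNSet a (NConst 0) (NConst 0) e.
Definition let_real a e := PRSet a (NConst 0) (NConst 0) e.
Definition for_vertices c P := PFor c 1 0 P.

(* Besides the cells fixed by [input] and [output], the integer arrays are:
   4: flag, 5: labels, 6: current set, 7 and 8: selected vertices, 9 and 10:
   labels to be merged, 12: best set, 20 to 25: loop counters; the real arrays are:
   2: p, 3: a, 4: w, 5: masked w, 6: sum of p, 7: sum of 1 / cap, 8: least cost
   of an edge, 9: cost of the current set, 10: cost of the best set, 11: alpha,
   12: maximum of a. *)
Definition nearest_prog :=
  PSeq (let_nat 7 (nvar 21))
    (for_vertices 22
       (PIf (BAnd (NLe (NConst 1) (NGet 1 (nvar 21) (nvar 22)))
                  (BNot (RLe (rarr 5 (nvar 7)) (rarr 5 (nvar 22)))))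
          (let_nat 7 (nvar 22)))).

Definition fill_prog :=
  for_vertices 21
    (PSeq nearest_prog
       (PSeq (PRSet 5 (nvar 7) (NConst 0) RZero)
             (PNSet 5 (nvar 21) (NConst 0) (nvar 7)))).

Definition mask_prog :=
  for_vertices 21
    (PSeq (PRSet 5 (nvar 21) (NConst 0) RZero)
          (PIf (RLe (rarr 0 (nvar 21)) (rarr 0 (nvar 20)))
             (PRSet 5 (nvar 21) (NConst 0) (rarr 4 (nvar 21))))).

Definition zeros_prog :=
  for_vertices 21
    (PSeq (PNSet 6 (nvar 21) (NConst 0) (NConst 0))
          (PIf (RLe (rarr 5 (nvar 21)) RZero)
             (PNSet 6 (nvar 21) (NConst 0) (NConst 1)))).

Definition edge_cost_rexp := RAdd (rarr 5 (nvar 21)) (rarr 5 (nvar 22)).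

Definition same_label_bexp :=
  BAnd (NLe (narr 5 (nvar 21)) (narr 5 (nvar 22)))
       (NLe (narr 5 (nvar 22)) (narr 5 (nvar 21))).

Definition scan_edges_prog :=
  for_vertices 22
    (PIf (BAnd (NLe (NConst 1) (NGet 1 (nvar 21) (nvar 22)))
            (BAnd (BNot same_label_bexp)
               (BNot (BAnd (NLe (NConst 1) (nvar 4))
                           (RLe (rvar 8) edge_cost_rexp)))))
       (PSeq (let_nat 4 (NConst 1))
          (PSeq (let_nat 7 (nvar 21))
             (PSeq (let_nat 8 (nvar 22)) (let_real 8 edge_cost_rexp))))).

Definition find_edge_prog :=
  PSeq (let_nat 4 (NConst 0)) (for_vertices 21 scan_edges_prog).

Definition relabel_prog :=
  for_vertices 21
    (PIf (BAnd (NLe (narr 5 (nvar 21)) (nvar 10)) (NLe (nvar 10) (narr 5 (nvar 21))))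
       (PNSet 5 (nvar 21) (NConst 0) (nvar 9))).

(** Both labels are saved first because relabelling overwrites the array they are read from. *)
Definition merge_prog :=
  PIf (NLe (NConst 1) (nvar 4))
    (PSeq (PNSet 6 (nvar 7) (NConst 0) (NConst 1))
       (PSeq (PNSet 6 (nvar 8) (NConst 0) (NConst 1))
          (PSeq (let_nat 9 (narr 5 (nvar 7)))
             (PSeq (let_nat 10 (narr 5 (nvar 8))) relabel_prog)))).

Definition connect_prog := for_vertices 23 (PSeq find_edge_prog merge_prog).

Definition set_cost_prog :=
  PSeq (let_real 9 RZero)
    (for_vertices 21
       (PIf (NLe (NConst 1) (narr 6 (nvar 21)))
          (let_real 9 (RAdd (rvar 9) (rarr 4 (nvar 21)))))).

Definition copy_set_prog :=
  for_vertices 21 (PNSet 12 (nvar 21) (NConst 0) (narr 6 (nvar 21))).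

(** The first candidate is kept unconditionally, since the stored cost may come from an earlier
    call. *)
Definition keep_prog :=
  PIf (BNot (BAnd (NLe (NConst 1) (nvar 20)) (RLe (rvar 10) (rvar 9))))
    (PSeq (let_real 10 (rvar 9)) copy_set_prog).

(** A vertex may enter the set after its label was written. The second [fill_prog] adds nothing and
    makes all labels refer to the final set. *)
Definition candidate_prog :=
  PSeq mask_prog (PSeq fill_prog (PSeq fill_prog
    (PSeq zeros_prog (PSeq connect_prog set_cost_prog)))).

(** There is one iteration more than there are vertices: the last one reads the capacity cell past
    the end, which holds 0, as its threshold. *)
Definition oracle_prog := PFor 20 1 1 (PSeq candidate_prog keep_prog).

Lemma run_seq (R : realType) P1 P2 (s : state R) :
  run (PSeq P1 P2) s = run P2 (run P1 s).
Proof. by []. Qed.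

Lemma run_if (R : realType) b P (s : state R) :
  run (PIf b P) s = if beval s b then run P s else s.
Proof. by []. Qed.

Lemma run_let_nat (R : realType) a e (s : state R) :
  run (let_nat a e) s = setn s a 0 0 (neval s e).
Proof. by []. Qed.

Lemma run_let_real (R : realType) a e (s : state R) :
  run (let_real a e) s = setr s a 0 0 (reval s e).
Proof. by []. Qed.

Lemma run_nset (R : realType) a i j e (s : state R) :
  run (PNSet a i j e) s = setn s a (neval s i) (neval s j) (neval s e).
Proof. by []. Qed.

Lemma run_rset (R : realType) a i j e (s : state R) :
  run (PRSet a i j e) s = setr s a (neval s i) (neval s j) (reval s e).
Proof. by []. Qed.

Definition runE := (run_seq, run_if, run_let_nat, run_let_real, run_nset, run_rset).

(** * Correctness of the oracle program *)

Section Specifications.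
Variables (R : realType) (G : sgraph) (cap : vertex G -> R).
Implicit Types (s : state R) (u v : 'I_(gorder G)).

Definition holds_input s :=
  [/\ nmem s 0 0 0 = gorder G,
      forall u v, nmem s 1 u v = adj u v :> nat,
      forall v, rmem s 0 v 0 = cap v
    & rmem s 0 (gorder G) 0 = 0].

Lemma holds_input_frame ns rs s s' : frame ns rs s s' ->
  0%N \notin ns -> 1%N \notin ns -> 0%N \notin rs -> holds_input s -> holds_input s'.
Proof.
by move=> [fn fr] n0 n1 r0; rewrite /holds_input fn // fn // fr.
Qed.

Definition rvec s a : vertex G -> R := fun v => rmem s a (nat_of_ord v) 0.

Lemma for_verticesP c P s (I : nat -> state R -> Prop) : nmem s 0 0 0 = gorder G ->
    I 0 (setn s c 0 0 0) ->
    (forall v s', nmem s' c 0 0 = v ->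
       frame (c :: written_nat P) (written_real P) s s' ->
       I v s' -> I v.+1 (setn (run P s') c 0 0 v.+1)) ->
  I (gorder G) (run (for_vertices c P) s).
Proof.
move=> n0 I0 IS; have := @run_for R c 1 0 P s I I0; rewrite mul1n addn0 n0.
by apply=> j s' jn cj fr; apply: (IS (Ordinal jn)).
Qed.

Lemma nearestP v s : holds_input s -> nmem s 21 0 0 = v ->
  exists b : 'I_(gorder G), [/\ nmem (run nearest_prog s) 7 0 0 = b, cadj v b,
    forall u, cadj v u -> rvec s 5 b <= rvec s 5 u
    & b = v \/ rvec s 5 b < rvec s 5 v].
Proof.
move=> inp sv; set s1 := run (let_nat 7 (nvar 21)) s.
have [n0 adjE _ _] := inp.
pose I j s' := exists b : 'I_(gorder G), [/\ nmem s' 7 0 0 = b, cadj v b,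
    forall u, cadj v u -> (u == v) || (u < j)%N -> rvec s 5 b <= rvec s 5 u
    & b = v \/ rvec s 5 b < rvec s 5 v].
suff [b [b7 vb min_b bv]] : I (gorder G) (run nearest_prog s).
  by exists b; split=> // u vu; apply: min_b; rewrite ?ltn_ord ?orbT.
rewrite /nearest_prog run_seq -/s1; apply: for_verticesP => //.
  exists v; split=> //; [by rewrite /cadj eqxx| |by left].
  by move=> u _; rewrite ltn0 orbF => /eqP->.
move=> u s' cu [fn fr] [b [b7 vb min_b bv]].
have ww : rmem s' 5 = rmem s 5 by rewrite fr.
have adj1 : nmem s' 1 = nmem s 1 by rewrite fn.
have c21 : nmem s' 21 0 0 = v by rewrite fn.
rewrite !runE /= cu b7 c21 adj1 ww adjE.
rewrite /I; case: ifP => [/andP[]|].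
  rewrite lt0b -ltNge => vu ub; exists u; split=> //.
  - by rewrite /cadj vu orbT.
  - move=> x vx; rewrite ltnS [(x <= u)%N]leq_eqVlt orbCA => /orP[/eqP/val_inj->//|xu].
    exact: ltW (lt_le_trans ub (min_b _ vx xu)).
  - right; case: bv => [<- //|]; exact: lt_trans.
move=> no; exists b; split=> // x vx.
rewrite ltnS [(x <= u)%N]leq_eqVlt orbCA => /orP[/eqP/val_inj xu|]; last exact: min_b.
move: no; rewrite -xu lt0b => /negbT; rewrite negb_and negbK.
case/orP => //; case/orP: vx => [/eqP-> _|-> //]; apply: min_b; rewrite /cadj ?eqxx //.
Qed.

Definition holds_set s a (D : {set vertex G}) := forall v, nmem s a v 0 = (v \in D) :> nat.

Definition holds_lab s (lab : vertex G -> vertex G) :=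
  forall v, nmem s 5 v 0 = nat_of_ord (lab v).

Lemma maskP s th : holds_input s -> nmem s 20 0 0 = th ->
  rvec (run mask_prog s) 5 =
    fun u => if u \in [set u | rmem s 0 th 0 < cap u] then 0 else rvec s 4 u.
Proof.
move=> [n0 _ capE _] sth.
pose I j s' := forall u, (u < j)%N -> rvec s' 5 u =
  if u \in [set u | rmem s 0 th 0 < cap u] then 0 else rvec s 4 u.
suff Iend : I (gorder G) (run mask_prog s) by apply/funext => u; apply: Iend.
apply: for_verticesP => // v s' cv [fn fr] Is u.
have r0 : rmem s' 0 = rmem s 0 by rewrite fr.
have r4 : rmem s' 4 = rmem s 4 by rewrite fr.
have n20 : nmem s' 20 = nmem s 20 by rewrite fn.
rewrite !runE /= cv /upd /= r0 n20 sth capE inE ltnS leq_eqVlt => /orP[/eqP/val_inj->|uv].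
  by rewrite ltNge; case: ifP => _ /=; rewrite updE !eqxx //= r4.
have neq : (nat_of_ord u == nat_of_ord v) = false by rewrite ltn_eqF.
have := Is u uv; rewrite inE => <-.
by case: ifP => _; rewrite /rvec /= !updE neq.
Qed.

Lemma zerosP s : holds_input s -> (forall u, 0 <= rvec s 5 u) ->
  holds_set (run zeros_prog s) 6 (zeros (rvec s 5)).
Proof.
move=> [n0 _ _ _] ww0.
pose I j s' := forall u, (u < j)%N -> nmem s' 6 u 0 = (u \in zeros (rvec s 5)) :> nat.
suff Iend : I (gorder G) (run zeros_prog s) by move=> u; apply: Iend.
apply: for_verticesP => // v s' cv [fn fr] Is u.
have r5 : rmem s' 5 = rmem s 5 by rewrite fr.
rewrite !runE /= cv /upd /= cv r5 inE ltnS leq_eqVlt => /orP[/eqP/val_inj->|uv].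
  rewrite -[rmem s 5 v 0]/(rvec s 5 v) (le_eqVlt _ 0) [_ < 0]ltNge ww0 orbF.
  by case: ifP => _ /=; rewrite updE !eqxx.
have neq : (nat_of_ord u == nat_of_ord v) = false by rewrite ltn_eqF.
have := Is u uv; rewrite inE => <-.
by case: ifP => _; rewrite /= !updE neq.
Qed.

Lemma reset_rvec s v : rvec (setr s 5 v 0 0) 5 = reset (rvec s 5) v.
Proof. by apply/funext => u; rewrite /rvec /reset /= updE andbT. Qed.

Section Oracle.
Variables (w : vertex G -> R) (d : nat) (o : rel (vertex G)).
Hypotheses (cap_ge0 : forall v, 0 <= cap v) (w_gt0 : forall v, 0 < w v).
Hypothesis o_total : forall x y, adj x y -> o x y || o y x.
Hypothesis o_out : forall x, (#|[set y | o x y]| <= d)%N.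

Lemma fillP s U : holds_input s -> fill_inv cap w d o U 0 (rvec s 5) ->
  fill_inv cap w d o U (gorder G) (rvec (run fill_prog s) 5).
Proof.
move=> inp fi; have [n0 _ _ _] := inp.
pose I j s' := fill_inv cap w d o U j (rvec s' 5).
rewrite -/(I _ _); apply: for_verticesP => // v s' cv fr Is.
have inp' : holds_input s' by apply: holds_input_frame fr _ _ _ inp.
have [b [b7 vb min_b _]] := nearestP inp' cv.
have [nfr rfr] := run_frame nearest_prog s'.
rewrite !runE /I -[rvec _ 5]/(rvec (setr (run nearest_prog s') 5
  (nmem (run nearest_prog s') 7 0 0) 0 0) 5) b7 reset_rvec.
by rewrite /rvec rfr //; apply: fill_step.
Qed.

(** Every closed neighbourhood already has a vertex of masked weight 0, so the selected vertex has
    weight 0 and resetting it changes nothing. *)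
Lemma fill_againP s : holds_input s -> (forall v, 0 <= rvec s 5 v) ->
    (forall v, exists2 u, cadj v u & rvec s 5 u = 0) ->
  rvec (run fill_prog s) 5 = rvec s 5 /\
  exists2 f, holds_lab (run fill_prog s) f & dominator (rvec s 5) f.
Proof.
move=> inp ww0 dom; have [n0 _ _ _] := inp.
pose I j s' := rvec s' 5 = rvec s 5 /\ forall v, (v < j)%N ->
  exists b : 'I_(gorder G), [/\ nmem s' 5 v 0 = b, cadj v b, rvec s 5 b = 0 &
    rvec s 5 v = 0 -> b = v].
suff [-> lab] : I (gorder G) (run fill_prog s).
  split=> //; pose f (v : vertex G) : vertex G := insubd v (nmem (run fill_prog s) 5 v 0).
  have fP v : [/\ nmem (run fill_prog s) 5 v 0 = nat_of_ord (f v), cadj v (f v),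
      rvec s 5 (f v) = 0 & rvec s 5 v = 0 -> f v = v].
    have [b [b5 vb b0 bv]] := lab v (ltn_ord v).
    suff -> : f v = b by [].
    by rewrite /f b5; apply: val_inj; rewrite val_insubd ltn_ord.
  exists f; first by move=> v; case: (fP v).
  by split=> v; case: (fP v).
apply: for_verticesP => // v s' cv fr [ww Is].
have inp' : holds_input s' by apply: holds_input_frame fr _ _ _ inp.
have [b [b7 vb min_b bv]] := nearestP inp' cv.
rewrite ww in min_b bv.
have b0 : rvec s 5 b = 0.
  have [u vu u0] := dom v; apply/eqP; rewrite eq_le ww0 andbT -u0.
  exact: min_b.
have [nfr rfr] := run_frame nearest_prog s'.
have n21 : nmem (run nearest_prog s') 21 0 0 = v by rewrite nfr.
have n5 : nmem (run nearest_prog s') 5 = nmem s' 5 by rewrite nfr.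
rewrite !runE; split.
  rewrite -[rvec _ 5]/(rvec (setr (run nearest_prog s') 5
    (nmem (run nearest_prog s') 7 0 0) 0 0) 5) b7 reset_rvec.
  have -> : rvec (run nearest_prog s') 5 = rvec s 5 by rewrite -ww /rvec rfr.
  by apply/funext => u; rewrite /reset; case: eqP => [->|].
move=> u; rewrite ltnS leq_eqVlt => /orP[/eqP/val_inj->|uv].
  exists b; split=> //; first by rewrite /= /upd /= n21 eqxx.
  by move=> v0; case: bv => // ; rewrite v0 b0 ltxx.
have [b' [b'5 ? ? ?]] := Is _ uv; exists b'; split=> //.
by rewrite /= /upd /= n21 ltn_eqF //= n5.
Qed.

(** [Q] delimits the ordered pairs scanned so far, so that one predicate serves both nested
    loops. *)
Definition found s (ww : vertex G -> R) (lab : vertex G -> vertex G)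
    (Q : vertex G -> vertex G -> Prop) :=
  (nmem s 4 0 0 = 0%N /\ forall x y, Q x y -> adj x y -> lab x = lab y) \/
  (nmem s 4 0 0 = 1%N /\ exists u v : 'I_(gorder G),
     [/\ nmem s 7 0 0 = u /\ nmem s 8 0 0 = v, adj u v, lab u != lab v,
        rmem s 8 0 0 = ww u + ww v
      & forall x y, Q x y -> adj x y -> lab x != lab y ->
          ww u + ww v <= ww x + ww y]).

Lemma found_weak s ww lab (Q Q' : vertex G -> vertex G -> Prop) :
  (forall x y, Q' x y -> Q x y) -> found s ww lab Q -> found s ww lab Q'.
Proof.
move=> QQ [[s4 same]|[s4 [u [v [uv7 uv lb r8 min_uv]]]]]; [left|right]; split=> //.
  by move=> x y /QQ; apply: same.
by exists u, v; split=> // x y /QQ; apply: min_uv.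
Qed.

Lemma find_edgeP s lab : holds_input s -> holds_lab s lab ->
  found (run find_edge_prog s) (rvec s 5) lab (fun _ _ => True).
Proof.
move=> inp sl; have [n0 adjE _ _] := inp.
pose I j s' := found s' (rvec s 5) lab (fun x _ => (nat_of_ord x < j)%N).
suff Iend : I (gorder G) (run find_edge_prog s).
  by apply: found_weak Iend => x y _; apply: ltn_ord.
rewrite /find_edge_prog run_seq; apply: for_verticesP => //; first by left; split.
move=> u s1 cu fr1 Iu.
(* The pairs scanned so far form an initial segment of the lexicographic order. *)
pose J j s' := found s' (rvec s 5) lab
  (fun x y => (nat_of_ord x < u)%N \/ x = u /\ (nat_of_ord y < j)%N).
suff Jend : J (gorder G) (run scan_edges_prog s1).
  apply: found_weak Jend => x y; rewrite ltnS leq_eqVlt => /orP[/eqP/val_inj->|]; last by left.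
  by right; rewrite ltn_ord.
have [fn1 fr1'] := fr1.
apply: for_verticesP; first by rewrite fn1.
  by apply: found_weak Iu => x y [//|[]].
move=> v s2 cv [fn2 fr2] Jv.
have n1 : nmem s2 1 = nmem s 1 by rewrite fn2 // fn1.
have n5 : nmem s2 5 = nmem s 5 by rewrite fn2 // fn1.
have r5 : rmem s2 5 = rmem s 5 by rewrite fr2 // fr1'.
have c21 : nmem s2 21 0 0 = u by rewrite fn2.
rewrite !runE /= /upd /= cv c21 n1 n5 r5 !sl adjE lt0b -eqn_leq -!/(rvec s 5 _).
set test := (_ && _).
have skip : test = false -> J v.+1 s2.
  move=> tF; case: Jv => [[s4 same]|[s4 [x [y [uv7 xy lb r8 min_xy]]]]]; [left|right]; split=> //.
    move=> a b [au|[-> ]]; first by apply: same; left.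
    rewrite ltnS leq_eqVlt => /orP[/eqP/val_inj->|bv]; last by apply: same; right.
    move=> uv; move: tF; rewrite /test uv s4 /= andbT => /negbFE/eqP.
    exact: val_inj.
  exists x, y; split=> // a b [au|[-> ]]; first by apply: min_xy; left.
  rewrite ltnS leq_eqVlt => /orP[/eqP/val_inj->|bv]; last by apply: min_xy; right.
  move=> uv nuv; move: tF; rewrite /test uv s4 /= r8 val_eqE nuv /= => /negbFE.
  by [].
case: ifP => [|/skip //]; rewrite /test => /and3P[uv nuv better]; right; split=> //.
exists u, v; split=> //.
move=> a b [au|[-> ]].
  case: Jv => [[_ same]|[s4 [x [y [_ xy lb r8 min_xy]]]]].
    by move=> ab; rewrite (same a b) ?eqxx //; left.
  move: better; rewrite s4 /= r8 -ltNge => /ltW better ab nab.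
  by apply: le_trans better _; apply: min_xy => //; left.
rewrite ltnS leq_eqVlt => /orP[/eqP/val_inj->|bv] //.
case: Jv => [[_ same]|[s4 [x [y [_ xy lb r8 min_xy]]]]].
  by move=> ab; rewrite (same u b) ?eqxx //; right.
move: better; rewrite s4 /= r8 -ltNge => /ltW better ab nab.
by apply: le_trans better _; apply: min_xy => //; right.
Qed.

Lemma relabelP s lab u v : holds_input s -> holds_lab s lab ->
    nmem s 9 0 0 = lab u -> nmem s 10 0 0 = lab v ->
  holds_lab (run relabel_prog s) (merge lab u v).
Proof.
move=> [n0 _ _ _] sl su sv.
pose I j s' := forall x : 'I_(gorder G), nmem s' 5 x 0 =
  nat_of_ord (if (x < j)%N then merge lab u v x else lab x).
suff Iend : I (gorder G) (run relabel_prog s) by move=> x; rewrite Iend ltn_ord.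
apply: for_verticesP => // y s' cy [fn _] Iy x.
have n9 : nmem s' 9 = nmem s 9 by rewrite fn.
have n10 : nmem s' 10 = nmem s 10 by rewrite fn.
rewrite !runE /= cy Iy ltnn n9 n10 su sv -eqn_leq val_eqE ltnS leq_eqVlt.
have [/eqP/val_inj->|xy] /= := boolP (nat_of_ord x == nat_of_ord y).
  rewrite /merge; case: ifP => _ /=; last by rewrite /upd /= Iy ltnn.
  by rewrite /upd /= eqxx.
by case: ifP => _ /=; rewrite /upd /= ?(negbTE xy) Iy.
Qed.

Lemma mergeP s lab D u v : holds_input s -> holds_lab s lab -> holds_set s 6 D ->
    nmem s 4 0 0 = 1%N -> nmem s 7 0 0 = u -> nmem s 8 0 0 = v ->
  holds_lab (run merge_prog s) (merge lab u v) /\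
  holds_set (run merge_prog s) 6 (u |: (v |: D)).
Proof.
move=> inp sl sD s4 s7 s8.
rewrite /merge_prog run_if ifT; last by rewrite /= s4.
rewrite !run_seq; set s' := run (let_nat 10 _) _.
have inp' : holds_input s' by [].
have sl' : holds_lab s' lab by [].
split.
  apply: relabelP => //; by rewrite /= /upd /= ?s7 ?s8 sl.
move=> x; have [fn _] := run_frame relabel_prog s'.
rewrite fn // /s' /= /upd /= s7 s8 sD !inE !andbT.
rewrite -[x == v]val_eqE -[x == u]val_eqE /=.
by do 2!case: eqP.
Qed.

Lemma connectP s (U : {set vertex G}) : holds_input s -> connected_graph G ->
    (exists r, excludes_clique G r /\ d = (2 ^ r.+1)%N) ->
    mask w (rvec s 5) -> {in U, forall u, rvec s 5 u = 0} ->
    (exists2 f, holds_lab s f & dominator (rvec s 5) f) ->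
    holds_set s 6 (zeros (rvec s 5)) ->
  exists D f lab, [/\ holds_set (run connect_prog s) 6 D, dominator (rvec s 5) f
    & conn_inv cap w d (rvec s 5) f U (gorder G) lab D].
Proof.
move=> inp cG [r [noK dr]] mw Uww [f sf domf] s6; have [n0 _ _ _] := inp.
pose I j s' := exists D lab, [/\ holds_set s' 6 D, holds_lab s' lab
    & conn_inv cap w d (rvec s 5) f U j lab D].
suff [D [lab [? ? ?]]] : I (gorder G) (run connect_prog s) by exists D, f, lab.
apply: for_verticesP => //.
  by exists (zeros (rvec s 5)), f; split=> //; apply: conn_init.
move=> j s1 _ fr1 [D [lab [sD sl ci]]].
have inp1 : holds_input s1 by apply: holds_input_frame fr1 _ _ _ inp.
have := find_edgeP inp1 sl; have [_ fr] := fr1.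
have -> : rvec s1 5 = rvec s 5 by rewrite /rvec fr.
rewrite run_seq; set s2 := run find_edge_prog s1.
have fr2 : frame _ _ s1 s2 := run_frame find_edge_prog s1.
have inp2 : holds_input s2 by apply: holds_input_frame fr2 _ _ _ inp1.
have sl2 : holds_lab s2 lab by move=> x; rewrite fr2.1.
have sD2 : holds_set s2 6 D by move=> x; rewrite fr2.1.
case=> [[s4 same]|[s4 [u [v [[s7 s8] uv lb _ min_uv]]]]].
  exists D, lab; rewrite /merge_prog run_if ifF; last by rewrite /= s4.
  split=> //.
  apply: conn_stop ci cG _ => x y; exact: same.
have [sl3 sD3] := mergeP inp2 sl2 sD2 s4 s7 s8.
exists (u |: (v |: D)), (merge lab u v); split=> //.
have labf : forall x, lab (f x) = lab x by case: ci.
by apply: (conn_step cap_ge0 w_gt0 noK dr mw domf Uww labf ci) => // x y; apply: min_uv.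
Qed.

Lemma set_costP s D : holds_input s -> rvec s 4 = w -> holds_set s 6 D ->
  rmem (run set_cost_prog s) 9 0 0 = \sum_(v in D) w v.
Proof.
move=> [n0 _ _ _] s4 sD.
pose I j s' := rmem s' 9 0 0 =
  \sum_(v < gorder G | (v < j)%N) (if v \in D then w v else 0).
suff : I (gorder G) (run set_cost_prog s).
  rewrite /I => ->; rewrite [RHS]big_mkcond; apply: eq_bigl => v.
  by rewrite ltn_ord.
rewrite /set_cost_prog run_seq; apply: for_verticesP => //.
  by rewrite /I big_pred0.
move=> v s' cv [fn fr] Iv.
have n6 : nmem s' 6 = nmem s 6 by rewrite fn.
have r4 : rmem s' 4 v 0 = w v by rewrite fr // -s4.
rewrite /I sum_ltS -Iv !runE /= cv n6 sD lt0b.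
by case: ifP => _ /=; rewrite /upd /= ?cv ?r4 ?addr0.
Qed.

Definition level s th : {set vertex G} := [set u | rmem s 0 th 0 < cap u].

(** Every threshold yields a connected dominating set; only the cost bound depends on [level s th]
    being the right set of heavy vertices. *)
Lemma candidateP s th : holds_input s -> nmem s 20 0 0 = th -> rvec s 4 = w ->
    connected_graph G -> (exists r, excludes_clique G r /\ d = (2 ^ r.+1)%N) ->
  exists D, [/\ holds_set (run candidate_prog s) 6 D, connected_dominating D,
    rmem (run candidate_prog s) 9 0 0 = \sum_(v in D) w v
  & forall k t, threshold cap d k t (level s th) ->
      k * (\sum_(v in D) w v) <= (8 * d + 2)%:R * total_cost cap w].
Proof.
move=> inp sth s4 cG noK; rewrite /candidate_prog !run_seq.
have fr1 : frame _ _ s (run mask_prog s) := run_frame mask_prog s.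
have ww1 := maskP inp sth; move: fr1 ww1; set s1 := run mask_prog s => fr1 ww1.
have inp1 : holds_input s1 by apply: holds_input_frame fr1 _ _ _ inp.
have fill1 : fill_inv cap w d o (level s th) 0 (rvec s1 5).
  by rewrite ww1 s4; apply: fill_init.
have fr2 : frame _ _ s1 (run fill_prog s1) := run_frame fill_prog s1.
have fill2 := fillP inp1 fill1.
move: fr2 fill2; set s2 := run fill_prog s1 => fr2 fill2.
have inp2 : holds_input s2 by apply: holds_input_frame fr2 _ _ _ inp1.
have [mw Uww dom _] := fill2.
have ww0 v : 0 <= rvec s2 5 v by case: (mw v) => ->; rewrite // ltW.
have [|ww3 [f sf domf]] := fill_againP inp2 ww0.
  by move=> v; apply: dom; apply: ltn_ord.
have fr3 : frame _ _ s2 (run fill_prog s2) := run_frame fill_prog s2.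
move: fr3 ww3 sf; set s3 := run fill_prog s2 => fr3 ww3 sf.
have inp3 : holds_input s3 by apply: holds_input_frame fr3 _ _ _ inp2.
have fr4 : frame _ _ s3 (run zeros_prog s3) := run_frame zeros_prog s3.
have D4 : holds_set (run zeros_prog s3) 6 (zeros (rvec s3 5)).
  by apply: zerosP => //; rewrite ww3.
move: fr4 D4; set s4' := run zeros_prog s3 => fr4 D4.
have inp4 : holds_input s4' by apply: holds_input_frame fr4 _ _ _ inp3.
have ww4 : rvec s4' 5 = rvec s2 5 by rewrite -ww3 /rvec fr4.2.
have sf4 : holds_lab s4' f by move=> v; rewrite fr4.1.
have := @connectP s4' (level s th) inp4 cG noK; rewrite ww4 => /(_ mw Uww).
case=> [||D [g [lab [sD domg ci]]]]; [by exists f|by rewrite -ww3|].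
have fr5 : frame _ _ s4' (run connect_prog s4') := run_frame connect_prog s4'.
move: fr5 sD; set s5 := run connect_prog s4' => fr5 sD.
have inp5 : holds_input s5 by apply: holds_input_frame fr5 _ _ _ inp4.
have w5 : rvec s5 4 = w.
  by rewrite -s4 /rvec fr5.2 // fr4.2 // fr3.2 // fr2.2 // fr1.2.
have cost5 := set_costP inp5 w5 sD.
have fr6 : frame _ _ s5 (run set_cost_prog s5) := run_frame set_cost_prog s5.
exists D; split=> //.
- by move=> v; rewrite fr6.1.
- by have [] := conn_final cap_ge0 cG mw domg ci.
- by move=> k t th'; apply: threshold_weight_bound fill2 domg ci th'.
Qed.

Lemma copy_setP s D : holds_input s -> holds_set s 6 D ->
  holds_set (run copy_set_prog s) 12 D.
Proof.
move=> [n0 _ _ _] sD.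
pose I j s' := forall u, (u < j)%N -> nmem s' 12 u 0 = (u \in D) :> nat.
suff Iend : I (gorder G) (run copy_set_prog s) by move=> u; apply: Iend.
apply: for_verticesP => // v s' cv [fn _] Iv u.
have n6 : nmem s' 6 = nmem s 6 by rewrite fn.
rewrite !runE /= /upd /= cv n6 sD ltnS leq_eqVlt => /orP[/eqP/val_inj->|uv].
  by rewrite eqxx.
by rewrite ltn_eqF //= Iv.
Qed.

Lemma oracleP s : holds_input s -> rvec s 4 = w -> connected_graph G ->
    (exists r, excludes_clique G r /\ d = (2 ^ r.+1)%N) ->
  exists D, holds_set (run oracle_prog s) 12 D /\
    oracle_set cap (8 * d + 2)%:R w D.
Proof.
move=> inp s4 cG noK; have [n0 _ capE cap0] := inp.
(* Before the first iteration there is no best set. Afterwards its cost is bounded for each tried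
   threshold that is right, because it is the cheapest so far. *)
pose I j s' := j = 0%N \/ exists D, [/\ holds_set s' 12 D, connected_dominating D,
  rmem s' 10 0 0 = \sum_(v in D) w v
  & forall th k t, (th < j)%N -> threshold cap d k t (level s th) ->
      k * (\sum_(v in D) w v) <= (8 * d + 2)%:R * total_cost cap w].
have : I (1 * nmem s 0 0 0 + 1)%N (run oracle_prog s).
  apply: run_for; first by left.
  move=> th s1 _ sth fr1 I1; right.
  have inp1 : holds_input s1 by apply: holds_input_frame fr1 _ _ _ inp.
  have w1 : rvec s1 4 = w by rewrite -s4 /rvec fr1.2.
  have lev : level s1 th = level s th by apply/setP => u; rewrite !inE fr1.2.
  rewrite run_seq.
  have [D []] := candidateP inp1 sth w1 cG noK; rewrite lev.
  have fr2 : frame _ _ s1 (run candidate_prog s1) := run_frame candidate_prog s1.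
  move: fr2; move: (run candidate_prog s1) => s2 fr2 sD cdD costD boundD.
  have inp2 : holds_input s2 by apply: holds_input_frame fr2 _ _ _ inp1.
  have sth2 : nmem s2 20 0 0 = th by rewrite fr2.1.
  have k_ge0 k t U : threshold cap d k t U -> 0 <= k.
    by case=> _ t0 -> _; rewrite mulrn_wge0 // mulr_ge0.
  rewrite /keep_prog run_if; case: ifP => test; rewrite /= in test.
    rewrite run_seq; set s3 := run (let_real _ _) s2.
    have inp3 : holds_input s3 by [].
    have sD3 : holds_set s3 6 D by [].
    exists D; split=> //.
    - by move=> v; rewrite /= upd_other // (copy_setP inp3 sD3).
    - by rewrite (run_frame copy_set_prog s3).2 //= updE.
    move=> th' k t; rewrite ltnS leq_eqVlt => /orP[/eqP->|lt_th]; first exact: boundD.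
    move=> thk; case: I1 => [th0|[D' [_ _ best1 bound1]]]; first by rewrite th0 in lt_th.
    apply: le_trans (bound1 _ _ _ lt_th thk).
    have k0 := k_ge0 _ _ _ thk.
    rewrite ler_wpM2l // -best1 -costD.
    move: test; rewrite sth2 (leq_trans _ lt_th) //= -ltNge (fr2.2 10%N) //.
    exact: ltW.
  move/negbFE: test => /andP[]; rewrite sth2 => th0.
  rewrite (fr2.2 10%N) // costD => le_best.
  case: I1 => [th0'|[D' [sD' cdD' best1 bound1]]]; first by rewrite th0' in th0.
  exists D'; split=> //.
  - by move=> v; rewrite /= upd_other // fr2.1.
  - by rewrite /= (fr2.2 10%N).
  move=> th' k t; rewrite ltnS leq_eqVlt => /orP[/eqP->|lt_th]; last exact: bound1.
  move=> thk; apply: le_trans (boundD _ _ thk).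
  have k0 := k_ge0 _ _ _ thk.
  by rewrite ler_wpM2l // -best1.
rewrite mul1n addn1 n0 => -[//|[D [sD cdD _ bound]]].
exists D; split=> //; split=> // k mink k0.
have [t [c [cE th]]] := exists_threshold d mink k0.
case: cE => [c0|[v cv]].
  by apply: (bound (gorder G) k t) => //; rewrite /level cap0 -c0.
apply: (bound (nat_of_ord (v : 'I_(gorder G))) k t); first exact: ltnW (ltn_ord v).
by rewrite /level capE -cv.
Qed.

End Oracle.

End Specifications.

(** * The packing program *)

Definition nat_rexp m := iter m (RAdd ROne) RZero.

Definition prices_prog C :=
  PSeq (let_real 6 RZero) (PSeq (let_real 7 RZero)
    (PSeq
       (for_vertices 21
          (PSeq (let_real 6 (RAdd (rvar 6) (rarr 2 (nvar 21))))
                (let_real 7 (RAdd (rvar 7) (RDiv ROne (rarr 0 (nvar 21)))))))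
       (for_vertices 21
          (PSeq (PRSet 4 (nvar 21) (NConst 0)
                   (RDiv (rarr 2 (nvar 21)) (rarr 0 (nvar 21))))
             (PIf (RLe (rarr 0 (nvar 21)) RZero)
                (PRSet 4 (nvar 21) (NConst 0)
                   (RMul (RAdd (RMul (nat_rexp C) (rvar 6)) ROne)
                         (RAdd (rvar 7) ROne)))))))).

Definition alpha_prog :=
  PSeq (let_nat 4 (NConst 0))
    (for_vertices 21
       (PIf (BAnd (NLe (NConst 1) (narr 12 (nvar 21)))
               (BNot (BAnd (NLe (NConst 1) (nvar 4))
                           (RLe (rvar 11) (rarr 0 (nvar 21))))))
          (PSeq (let_nat 4 (NConst 1)) (let_real 11 (rarr 0 (nvar 21)))))).

Definition update_prog :=
  for_vertices 21
    (PSeq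
       (PIf (NLe (NConst 1) (narr 12 (nvar 21)))
          (PSeq (PRSet 3 (nvar 21) (NConst 0)
                   (RAdd (rarr 3 (nvar 21)) (RDiv (rvar 11) (rarr 0 (nvar 21)))))
                (PRSet 2 (nvar 21) (NConst 0)
                   (RMul (rarr 2 (nvar 21))
                      (RAdd ROne (RDiv (rvar 11) (rarr 0 (nvar 21))))))))
       (PNSet 3 (nvar 2) (nvar 21) (narr 12 (nvar 21)))).

Definition store_prog :=
  PSeq (PRSet 1 (nvar 2) (NConst 0) (rvar 11))
       (let_nat 2 (NAdd (nvar 2) (NConst 1))).

Definition round_prog C :=
  PSeq (prices_prog C)
    (PSeq oracle_prog (PSeq alpha_prog (PSeq update_prog store_prog))).

(** Loop bounds are linear in the order, so a quadratic number of rounds takes two nested loops. *)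
Definition rounds P := PFor 24 4 0 (for_vertices 25 P).

Definition init_prog := for_vertices 21 (PRSet 2 (nvar 21) (NConst 0) ROne).

Definition max_prog :=
  PSeq (let_real 12 RZero)
    (for_vertices 21
       (PIf (RLe (rvar 12) (rarr 3 (nvar 21))) (let_real 12 (rarr 3 (nvar 21))))).

(** The cell with the number of sets is reused as running index; it ends at its former value because
    there are as many scalings as rounds. *)
Definition scale_prog :=
  PSeq (let_nat 2 (NConst 0))
    (rounds
       (PSeq (PRSet 1 (nvar 2) (NConst 0) (RDiv (rarr 1 (nvar 2)) (rvar 12)))
             (let_nat 2 (NAdd (nvar 2) (NConst 1))))).

Definition packing_prog C :=
  PSeq init_prog (PSeq (rounds (round_prog C)) (PSeq max_prog scale_prog)).

(** * Correctness of the packing program *)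

Section MainSpecifications.
Variables (R : realType) (G : sgraph) (cap : vertex G -> R).
Hypothesis cap_ge0 : forall v, 0 <= cap v.
Implicit Types (s : state R) (u v : 'I_(gorder G)).

Lemma reval_nat_rexp m s : reval s (nat_rexp m) = m%:R.
Proof. by elim: m => //= m ->; rewrite -natr1 addrC. Qed.

Lemma roundsP P s (J : nat -> state R -> Prop) : nmem s 0 0 0 = gorder G ->
    0%N \notin written_nat P ->
    (forall j s' c x, c \in [:: 24%N; 25%N] -> J j s' -> J j (setn s' c 0 0 x)) ->
    J 0 s ->
    (forall j s', frame (24%N :: 25%N :: written_nat P) (written_real P) s s' ->
       J j s' -> J j.+1 (run P s')) ->
  J (4 * gorder G * gorder G)%N (run (rounds P) s).
Proof.
move=> n0 P0 Jc J0 JS.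
have := @run_for R 24 4 0 (for_vertices 25 P) s (fun j => J (j * gorder G)%N).
rewrite addn0 n0; apply; first exact: Jc.
move=> j s1 _ _ fr1 Jj; apply: (Jc _) => //.
have n1 : nmem s1 0 0 0 = gorder G by rewrite fr1.1 // !inE.
pose K i s' := J (j * gorder G + i)%N s'.
suff : K (gorder G) (run (for_vertices 25 P) s1) by rewrite /K mulSn addnC.
apply: for_verticesP => //; first by apply: Jc; rewrite ?addn0.
move=> v s2 _ fr2 Jv; apply: (Jc _) => //; rewrite addnS -/(K _ _); apply: JS => //.
by apply: frame_trans fr1 _; apply: frame_sub fr2 => // a aP; rewrite inE aP orbT.
Qed.

Lemma pricesP C s : holds_input cap s ->
  rvec (run (prices_prog C) s) 4 = prices cap C%:R (rvec s 2).
Proof.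
move=> inp; have [n0 _ capE _] := inp.
rewrite /prices_prog !run_seq; set s1 := run (let_real 7 _) _.
set sums := for_vertices 21 (PSeq (let_real 6 _) _).
have inp1 : holds_input cap s1 by [].
pose I j s' := rmem s' 6 0 0 = \sum_(v < gorder G | (v < j)%N) rvec s 2 v /\
               rmem s' 7 0 0 = \sum_(v < gorder G | (v < j)%N) (cap v)^-1.
have : I (gorder G) (run sums s1).
  apply: for_verticesP => //; first by rewrite /I !big_pred0.
  move=> v s' cv [fn fr] [I6 I7].
  have r0 : rmem s' 0 = rmem s 0 by rewrite fr.
  have r2 : rmem s' 2 = rmem s 2 by rewrite fr.
  by rewrite /I !sum_ltS -I6 -I7 !runE /= /upd /= cv r0 r2 capE div1r.
have fr2 : frame _ _ s1 (run sums s1) := run_frame sums s1.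
move: fr2; move: (run sums s1) => s2 fr2 [I6 I7].
have inp2 : holds_input cap s2 by apply: holds_input_frame fr2 _ _ _ inp1.
have [n2 _ cap2 _] := inp2.
set Q := PSeq _ _.
pose J j s' := forall u, (u < j)%N -> rvec s' 4 u = prices cap C%:R (rvec s 2) u.
suff Jend : J (gorder G) (run (for_vertices 21 Q) s2) by apply/funext => u; apply: Jend.
apply: for_verticesP => // v s' cv [fn fr] Jv u.
have r0 : rmem s' 0 = rmem s2 0 by rewrite fr.
have r2 : rmem s' 2 = rmem s 2 by rewrite fr // fr2.2.
have r6 : rmem s' 6 = rmem s2 6 by rewrite fr.
have r7 : rmem s' 7 = rmem s2 7 by rewrite fr.
rewrite /Q !runE /= reval_nat_rexp cv /upd /= r0 r2 r6 r7 I6 I7 cap2.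
have full F : \sum_(x < gorder G | (x < gorder G)%N) F x = \sum_(x < gorder G) F x :> R.
  by apply: eq_bigl => x; rewrite ltn_ord.
rewrite !full ltnS leq_eqVlt => /orP[/eqP/val_inj->|uv].
  by rewrite /prices /rvec; case: ifP => _ /=; rewrite updE !eqxx.
have neq : (nat_of_ord u == nat_of_ord v) = false by rewrite ltn_eqF.
by rewrite -(Jv u uv) /rvec; case: ifP => _ /=; rewrite !updE neq.
Qed.

Lemma alphaP s D : holds_input cap s -> holds_set s 12 D -> D != set0 ->
  let alpha := rmem (run alpha_prog s) 11 0 0 in
  {in D, forall v, alpha <= cap v} /\ exists2 v, v \in D & alpha = cap v.
Proof.
move=> [n0 _ capE _] sD /set0Pn[v0 v0D].
pose I j s' := (nmem s' 4 0 0 = 0%N /\ forall v, (v < j)%N -> v \notin D) \/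
  (nmem s' 4 0 0 = 1%N /\ (forall v, v \in D -> (v < j)%N -> rmem s' 11 0 0 <= cap v) /\
   exists2 v : vertex G, v \in D & rmem s' 11 0 0 = cap v).
suff : I (gorder G) (run alpha_prog s).
  case=> [[_ noD]|[_ [le_cap ex]]] /=.
    by have := noD v0 (ltn_ord _); rewrite v0D.
  by split=> // v vD; apply: le_cap.
rewrite /alpha_prog run_seq; apply: for_verticesP => //; first by left.
move=> v s' cv [fn fr] Iv.
have r0 : rmem s' 0 = rmem s 0 by rewrite fr.
have n12 : nmem s' 12 = nmem s 12 by rewrite fn.
rewrite !runE /= /upd /= cv r0 n12 sD capE lt0b.
case: ifP => [/andP[vD better]|no].
  right; split=> //; split; last by exists v.
  move=> u uD; rewrite ltnS leq_eqVlt /upd /= => /orP[/eqP/val_inj->//|uv].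
  case: Iv => [[_ noD]|[s4 [le_cap _]]]; first by rewrite (negbTE (noD u uv)) in uD.
  by move: better; rewrite s4 /= -ltNge => /ltW lt_v; apply: le_trans lt_v (le_cap u uD uv).
case: Iv => [[s4 noD]|[s4 [le_cap ex]]]; [left|right].
  split=> // u; rewrite ltnS leq_eqVlt => /orP[/eqP/val_inj->|]; last exact: noD.
  by move: no; rewrite s4 /= andbT => ->.
split=> //; split=> // u uD; rewrite ltnS leq_eqVlt => /orP[/eqP/val_inj uv|]; last exact: le_cap.
by move: no; rewrite -uv uD s4 /= => /negbFE.
Qed.

Lemma updateP s D : holds_input cap s -> holds_set s 12 D ->
  let s' := run update_prog s in let alpha := rmem s 11 0 0 in
  [/\ rvec s' 2 = (fun v => if v \in D then rvec s 2 v * (1 + alpha / cap v)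
                            else rvec s 2 v),
      rvec s' 3 = (fun v => if v \in D then rvec s 3 v + alpha / cap v
                            else rvec s 3 v),
      forall i j, i != nmem s 2 0 0 -> nmem s' 3 i j = nmem s 3 i j
    & forall v, nmem s' 3 (nmem s 2 0 0) v = (v \in D)].
Proof.
move=> [n0 _ capE _] sD; set alpha := rmem s 11 0 0.
pose I j s' :=
  [/\ forall v, rvec s' 2 v = if (v < j)%N && (v \in D)
        then rvec s 2 v * (1 + alpha / cap v) else rvec s 2 v,
      forall v, rvec s' 3 v = if (v < j)%N && (v \in D)
        then rvec s 3 v + alpha / cap v else rvec s 3 v,
      forall i j, i != nmem s 2 0 0 -> nmem s' 3 i j = nmem s 3 i j
    & forall v, (v < j)%N -> nmem s' 3 (nmem s 2 0 0) v = (v \in D)].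
suff [I1 I2 I3 I4] : I (gorder G) (run update_prog s).
  split=> //; [apply/funext => v|apply/funext => v|].
  - by rewrite I1 ltn_ord.
  - by rewrite I2 ltn_ord.
  - by move=> v; apply: I4.
apply: for_verticesP => // v s' cv [fn fr] [I1 I2 I3 I4].
have r0 : rmem s' 0 = rmem s 0 by rewrite fr.
have r11 : rmem s' 11 = rmem s 11 by rewrite fr.
have n12 : nmem s' 12 = nmem s 12 by rewrite fn.
have n2 : nmem s' 2 = nmem s 2 by rewrite fn.
rewrite !runE /= cv /upd /= r0 r11 n12 sD capE lt0b.
set s2 := (if _ then _ else _).
have s2n : nmem s2 = nmem s' by rewrite /s2; case: ifP.
have s22 u : rvec s2 2 u = if (v \in D) && (u == v)
    then rvec s 2 v * (1 + alpha / cap v) else rvec s' 2 u.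
  have := I1 v; rewrite ltnn /rvec /= /s2 => <-.
  by case: (v \in D) => //=; rewrite updE -val_eqE /= andbT.
have s23 u : rvec s2 3 u = if (v \in D) && (u == v)
    then rvec s 3 v + alpha / cap v else rvec s' 3 u.
  have := I2 v; rewrite ltnn /rvec /= /s2 => <-.
  by case: (v \in D) => //=; rewrite upd_other // updE -val_eqE /= andbT.
have c2 : nmem s2 2 0 0 = nmem s 2 0 0 by rewrite s2n n2.
have c21 : nmem s2 21 0 0 = v by rewrite s2n.
have c12 : nmem s2 12 v 0 = (v \in D) by rewrite s2n n12 sD.
split.
- move=> u; rewrite -[LHS]/(rvec s2 2 u) s22 I1 ltnS [(u <= v)%N]leq_eqVlt -val_eqE /=.
  have [/val_inj->|] := eqVneq (nat_of_ord u) v; last by rewrite andbF.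
  by rewrite ltnn andbT.
- move=> u; rewrite -[LHS]/(rvec s2 3 u) s23 I2 ltnS [(u <= v)%N]leq_eqVlt -val_eqE /=.
  have [/val_inj->|] := eqVneq (nat_of_ord u) v; last by rewrite andbF.
  by rewrite ltnn andbT.
- move=> i j i_ne; rewrite /= upd_other // updE c2 (negbTE i_ne) s2n; exact: I3.
move=> u; rewrite ltnS leq_eqVlt /= upd_other // updE c2 c21 eqxx /=.
case: (eqVneq (nat_of_ord u) v) => [/val_inj-> _|_ /= uv]; first exact: c12.
by rewrite s2n I4.
Qed.

Lemma output_store s s' D : holds_set s 12 D ->
    (forall i j, i != nmem s 2 0 0 -> nmem s' 3 i j = nmem s 3 i j) ->
    (forall v, nmem s' 3 (nmem s 2 0 0) v = (v \in D)) ->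
    nmem s' 2 = nmem s 2 -> rmem s' 1 = rmem s 1 ->
  output G (run store_prog s') = rcons (output G s) (D, rmem s' 11 0 0).
Proof.
move=> sD old new n2 r1; rewrite /output /store_prog !runE /= /upd /= n2.
set c := nmem s 2 0 0; rewrite addn1 -[c.+1]addn1 iotaD map_cat /= cats1; congr rcons.
  apply/eq_in_map => i; rewrite mem_iota add0n => /andP[_ ic].
  rewrite ltn_eqF //= r1; congr (_, _); apply/setP => v.
  by rewrite !inE old // neq_ltn ic.
rewrite add0n !eqxx /=; congr (_, _); apply/setP => v.
by rewrite !inE new; case: (v \in D).
Qed.

Definition round_inv C j s :=
  [/\ holds_input cap s, nmem s 2 0 0 = j
    & packing_inv cap C (rvec s 2) (rvec s 3) (output G s)].

Lemma roundP d C j s : connected_graph G ->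
    (exists r, excludes_clique G r /\ d = (2 ^ r.+1)%N) -> C = (8 * d + 2)%N ->
  round_inv C%:R j s -> round_inv C%:R j.+1 (run (round_prog C) s).
Proof.
move=> cG noK CE [inp sj pinv].
have [r [noKr dr]] := noK.
have [o [o_total o_out]] := exists_vertex_orientation noKr; rewrite -dr in o_out.
have p0 v : 0 < rvec s 2 v.
  by case: pinv => _ ap _ _ _; apply: lt_le_trans (ap v); apply: expR_gt0.
have C0 : 0 <= C%:R :> R by [].
have w0 v : 0 < prices cap C%:R (rvec s 2) v by apply: prices_gt0.
rewrite -[run _ s]/(run store_prog (run update_prog (run alpha_prog
  (run oracle_prog (run (prices_prog C) s))))).
have fr1 : frame _ _ s (run (prices_prog C) s) := run_frame (prices_prog C) s.
have w1 := pricesP C inp.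
move: fr1 w1; move: (run (prices_prog C) s) => s1 fr1 w1.
have inp1 : holds_input cap s1 by apply: holds_input_frame fr1 _ _ _ inp.
have := oracleP cap_ge0 w0 o_total o_out inp1 w1 cG noK; rewrite -CE => -[D [sD orD]].
have fr2 : frame _ _ s1 (run oracle_prog s1) := run_frame oracle_prog s1.
move: fr2 sD; move: (run oracle_prog s1) => s2 fr2 sD.
have inp2 : holds_input cap s2 by apply: holds_input_frame fr2 _ _ _ inp1.
have D0 : D != set0.
  by case: orD => /andP[_ /connected_set_neq0].
have [le_cap ex_cap] := alphaP inp2 sD D0.
have fr3 : frame _ _ s2 (run alpha_prog s2) := run_frame alpha_prog s2.
move: fr3 le_cap ex_cap; move: (run alpha_prog s2) => s3 fr3 le_cap ex_cap.
have inp3 : holds_input cap s3 by apply: holds_input_frame fr3 _ _ _ inp2.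
have sD3 : holds_set s3 12 D by move=> v; rewrite fr3.1.
have [p4 a4 old new] := updateP inp3 sD3.
have fr4 : frame _ _ s3 (run update_prog s3) := run_frame update_prog s3.
move: fr4 p4 a4 old new; move: (run update_prog s3) => s4 fr4 p4 a4 old new.
have inp4 : holds_input cap s4 by apply: holds_input_frame fr4 _ _ _ inp3.
have p3 : rvec s3 2 = rvec s 2 by rewrite /rvec fr3.2 // fr2.2 // fr1.2.
have a3 : rvec s3 3 = rvec s 3 by rewrite /rvec fr3.2 // fr2.2 // fr1.2.
have n3 : nmem s3 2 = nmem s 2 by rewrite fr3.1 // fr2.1 // fr1.1.
have r41 : rmem s4 1 = rmem s3 1 by rewrite fr4.2.
have n42 : nmem s4 2 = nmem s3 2 by rewrite fr4.1.
have out3 : output G s3 = output G s.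
  by rewrite /output n3 fr3.1 // fr2.1 // fr1.1 // fr3.2 // fr2.2 // fr1.2.
have out := output_store sD3 old new n42 r41.
have r11 : rmem s4 11 = rmem s3 11 by rewrite fr4.2.
have := packing_step cap_ge0 C0 pinv orD le_cap ex_cap.
rewrite -p3 -a3 -p4 -a4 -out3 -r11 -out => pinv'.
have n5 : nmem (run store_prog s4) 2 0 0 = j.+1.
  by rewrite /store_prog !runE /= updE /= n42 n3 sj addn1.
split; [|exact: n5|exact: pinv'].
exact: (holds_input_frame (run_frame store_prog s4)).
Qed.

(** Loads are nonnegative and the comparison is not strict, so the first vertex replaces the initial
    0 and the final value is attained. *)
Lemma maxP s : holds_input cap s -> (0 < gorder G)%N -> (forall v, 0 <= rvec s 3 v) ->
  let M := rmem (run max_prog s) 12 0 0 in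
  (forall v, rvec s 3 v <= M) /\ exists v, rvec s 3 v = M.
Proof.
move=> [n0 _ _ _] n_gt0 a0.
pose I j s' := (forall v, (v < j)%N -> rvec s 3 v <= rmem s' 12 0 0) /\
  ((j = 0%N /\ rmem s' 12 0 0 = 0) \/ exists v, rvec s 3 v = rmem s' 12 0 0).
suff : I (gorder G) (run max_prog s).
  case=> le_M ex; split=> [v|]; first exact: le_M.
  by case: ex => [[n_eq0 _]|//]; rewrite n_eq0 in n_gt0.
rewrite /max_prog run_seq; apply: for_verticesP => //; first by split=> //; left.
move=> v s' cv [_ fr] [le_M ex].
have r3 : rmem s' 3 = rmem s 3 by rewrite fr.
rewrite !runE /= cv r3; case: ifP => /= test; split.
- move=> u; rewrite /= /upd /= ?cv ?r3 ltnS leq_eqVlt => /orP[/eqP/val_inj->//|uv].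
  exact: le_trans (le_M u uv) test.
- by right; exists v; rewrite /= /upd /= ?cv ?r3.
- move=> u; rewrite ltnS leq_eqVlt => /orP[/eqP/val_inj->//|]; last exact: le_M.
  by rewrite ltW // ltNge test.
- case: ex => [[v0 M0]|]; last by right.
  by move: test; rewrite M0 -[rmem s 3 v 0]/(rvec s 3 v) a0.
Qed.

Lemma scaleP s : holds_input cap s -> nmem s 2 0 0 = (4 * gorder G * gorder G)%N ->
  output G (run scale_prog s) = scale (rmem s 12 0 0) (output G s).
Proof.
move=> inp s2; have [n0 _ _ _] := inp; set M := rmem s 12 0 0.
pose J j s' := nmem s' 2 0 0 = j /\ forall i, rmem s' 1 i 0 =
  if (i < j)%N then rmem s 1 i 0 / M else rmem s 1 i 0.
have [] : J (4 * gorder G * gorder G)%N (run scale_prog s).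
  rewrite /scale_prog run_seq; apply: roundsP => //.
    by move=> j s' c x; rewrite !inE => /orP[] /eqP->.
  move=> j s' fr [s'2 s'1].
  have r12 : rmem s' 12 0 0 = M by rewrite fr.2.
  rewrite !runE /= /upd /= s'2 r12; split=> [|i] /=.
    by rewrite /upd /= addn1.
  rewrite /upd /= andbT ltnS leq_eqVlt; case: eqVneq => [->|_] //=.
  by rewrite s'1 ltnn.
have fr : frame _ _ s (run scale_prog s) := run_frame scale_prog s.
move: fr; move: (run scale_prog s) => s' fr s'2 s'1.
rewrite /output /scale -map_comp s'2 s2 (fr.1 3%N) //.
apply/eq_in_map => i; rewrite mem_iota add0n => /andP[_ i_lt] /=.
by rewrite s'1 i_lt.
Qed.

Lemma holds_input_input : holds_input cap (input cap).
Proof.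
split=> //= [u v|v|].
- by rewrite !valK.
- by rewrite valK.
- by rewrite insubN // ltnn.
Qed.

Lemma initP C : round_inv C 0 (run init_prog (input cap)).
Proof.
have inp := holds_input_input; have [n0 _ _ _] := inp.
have fr := run_frame init_prog (input cap).
have p1 : rvec (run init_prog (input cap)) 2 = (fun=> 1) :> (vertex G -> R).
  pose I j (s : state R) := forall v, (v < j)%N -> rvec s 2 v = 1.
  suff Iend : I (gorder G) (run init_prog (input cap)).
    by apply/funext => v; apply: Iend.
  apply: for_verticesP => // v s cv _ Iv u.
  rewrite /rvec !runE /= updE cv andbT ltnS leq_eqVlt.
  by case: eqVneq => //= _; apply: Iv.
split; [exact: holds_input_frame fr _ _ _ inp|by rewrite fr.1|].
have -> : output G (run init_prog (input cap)) = [::] by rewrite /output (fr.1 2%N).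
have -> : rvec (run init_prog (input cap)) 3 = (fun=> 0) :> (vertex G -> R) by rewrite /rvec fr.2.
by rewrite p1; apply: packing_init.
Qed.

Lemma packing_progP d C : connected_graph G ->
    (exists r, excludes_clique G r /\ d = (2 ^ r.+1)%N) -> C = (8 * d + 2)%N ->
  let L := output G (run (packing_prog C) (input cap)) in
  fractional_cd_packing cap L /\
  forall k, min_separator_capacity cap k -> (4 * C%:R)^-1 * k <= packing_size L.
Proof.
move=> cG noK CE.
rewrite -[run _ _]/(run scale_prog (run max_prog (run (rounds (round_prog C))
  (run init_prog (input cap))))).
have := initP C%:R; move: (run init_prog (input cap)) => s0 inv0.
have [[n0 _ _ _] _ _] := inv0.
have : round_inv C%:R (4 * gorder G * gorder G) (run (rounds (round_prog C)) s0).
  apply: roundsP => //.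
    by move=> j s c x; rewrite !inE => /orP[] /eqP->.
  by move=> j s _; apply: roundP cG noK CE.
move: (run (rounds _) s0) => s1 [inp1 c1 pinv].
have n_gt0 : (0 < gorder G)%N.
  by case/connected_setP: cG => [[v _] _]; case: v => m; apply: leq_ltn_trans.
have a0 : forall v : 'I_(gorder G), 0 <= rvec s1 3 v by case: pinv.
have [le_M ex_M] := maxP inp1 n_gt0 a0.
have fr2 := run_frame max_prog s1.
move: le_M ex_M fr2; move: (run max_prog s1) => s2 le_M ex_M fr2.
have inp2 : holds_input cap s2 by apply: holds_input_frame fr2 _ _ _ inp1.
have c2 : nmem s2 2 0 0 = (4 * gorder G * gorder G)%N by rewrite fr2.1.
have -> : output G (run scale_prog s2) = scale (rmem s2 12 0 0) (output G s1).
  rewrite (scaleP inp2 c2) /output (fr2.1 2%N) // (fr2.1 3%N) //.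
  by rewrite (fr2.2 1%N).
apply: (packing_final cap_ge0 _ pinv cG) => //.
by rewrite size_map size_iota.
Qed.

End MainSpecifications.

Theorem theorem1 (R : realType) (F : sgraph -> Prop) :
  minor_closed F -> proper_family F ->
  exists (c : R) (P : cmd) (p : {poly nat}),
    0 < c /\
    forall (G : sgraph) (cap : vertex G -> R),
      F G -> connected_graph G -> (forall v, 0 <= cap v) ->
      exists (t : nat) (s : state R),
        [/\ exec P (input cap) t s,
            (t <= p.[gorder G])%N,
            fractional_cd_packing cap (output G s)
          & forall k : R, min_separator_capacity cap k ->
              c * k <= packing_size (output G s)].
Proof.
move=> cF [H nFH].
(* A complete graph on [gorder H] vertices is excluded as a minor; [d] bounds the outdegrees, and
   [C] is the constant of [threshold_weight_bound]. *)
pose d := (2 ^ (gorder H).+1)%N; pose C := (8 * d + 2)%N.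
exists (4 * C%:R)^-1, (compile (packing_prog C)), (cost (packing_prog C)).
split; first by rewrite invr_gt0 mulr_gt0 // ltr0n /C addn2.
move=> G cap FG cG cap_ge0.
have noK : exists r, excludes_clique G r /\ d = (2 ^ r.+1)%N.
  by exists (gorder H); split=> //; apply: minor_excludes_clique nFH FG.
have [t et let_] := @exec_run R (packing_prog C) (input cap) isT isT.
have [fcd size_ge] := packing_progP cap_ge0 cG noK (erefl C).
by exists t, (run (packing_prog C) (input cap)); split.
Qed.
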